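(* Let $n$ be a positive integer, let $f:\mathbb{R}^n\to\mathbb{R}$ be an almost periodic function, and let $u$ be a bounded generalized function in $\mathbb{R}^n$ which solves Poisson's equation $-\Delta u=f$ in $\mathbb{R}^n$ in the sense of distributions. Then $u$ is a continuous and bounded function in $\mathbb{R}^n$ (that is, the distribution $u$ is given by a bounded continuous function on $\mathbb{R}^n$).
   Context: A function $g:\mathbb{R}^n\to\mathbb{R}$ is called almost periodic if it is continuous on $\mathbb{R}^n$ and for every sequence of points $(x_k)$ in $\mathbb{R}^n$ the sequence of translates $x\mapsto g(x+x_k)$ contains a subsequence converging uniformly on $\mathbb{R}^n$. $\mathcal{D}(\mathbb{R}^n)$ denotes the set of infinitely differentiable functions $\phi:\mathbb{R}^n\to\mathbb{R}$ with compact support, and $(g,\phi)$ denotes the value of a distribution $g$ on $\phi\in\mathcal{D}(\mathbb{R}^n)$. A distribution $g$ on $\mathbb{R}^n$ is called a bounded generalized function if for every $\varphi\in\mathcal{D}(\mathbb{R}^n)$ the function $(g*\varphi)(x)=(g(y),\varphi(x-y))$ is bounded on $\mathbb{R}^n$, i.e. $\sup_{x\in\mathbb{R}^n}|(g*\varphi)(x)|<\infty$. The distribution $u$ solves $-\Delta u=f$ in the sense of distributions if $-(u,\Delta\phi)=\int_{\mathbb{R}^n}f\,\phi\,dx$ for every $\phi\in\mathcal{D}(\mathbb{R}^n)$. *)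

(* Defs.v *)
From HB Require Import structures.
From mathcomp Require Import all_boot all_order all_algebra.
From mathcomp Require Import all_classical all_reals all_analysis.

Set Implicit Arguments.
Unset Strict Implicit.
Unset Printing Implicit Defensive.

Import Order.TTheory GRing.Theory Num.Theory.
Import numFieldNormedType.Exports.

Local Open Scope classical_set_scope.
Local Open Scope ring_scope.

Section lebesgue_on_tuples.
Variable R : realType.
Local Open Scope ereal_scope.

Local Notation T := (measurableTypeR R).

Definition tcons (n : nat) (p : T * n.-tuple T) : n.+1.-tuple T :=
  [the n.+1.-tuple T of p.1 :: p.2].

Definition tuncons (n : nat) (t : n.+1.-tuple T) : T * n.-tuple T :=
  (thead t, [tuple of behead t]).

Lemma tconsK n : cancel (@tcons n) (@tuncons n).
Proof.
move=> [x t]; rewrite /tcons /tuncons; congr pair => /=.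
exact/val_inj.
Qed.

Lemma measurable_tcons n : measurable_fun setT (@tcons n).
Proof. exact: measurable_cons. Qed.

Lemma measurable_tuncons n : measurable_fun setT (@tuncons n).
Proof.
apply/measurable_fun_pairP; split; first exact: measurable_tnth.
exact: measurable_behead.
Qed.

Section step.
Variables (n : nat) (mu : {sigma_finite_measure set (n.-tuple T) -> \bar R}).

Definition lebesgue_step : set (n.+1.-tuple T) -> \bar R :=
  pushforward (@lebesgue_measure R \x mu) (@tcons n).

Let lebesgue_step0 : lebesgue_step set0 = 0.
Proof. by rewrite /lebesgue_step /pushforward preimage_set0 measure0. Qed.

Let lebesgue_step_ge0 A : 0 <= lebesgue_step A.
Proof. by rewrite /lebesgue_step /pushforward; exact: measure_ge0. Qed.

Let lebesgue_step_sigma_additive : semi_sigma_additive lebesgue_step.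
Proof.
have mt A : measurable A -> measurable (@tcons n @^-1` A).
  by move=> mA; rewrite -[X in measurable X]setTI; exact: measurable_tcons.
move=> F mF tF mUF; rewrite /lebesgue_step /pushforward preimage_bigcup.
apply: measure_semi_sigma_additive => [k||]; first exact: mt.
- apply/trivIsetP => i j _ _ ij; rewrite -preimage_setI.
  by move/trivIsetP : tF => /(_ _ _ _ _ ij) ->//; rewrite preimage_set0.
- by rewrite -preimage_bigcup; exact: mt.
Qed.

HB.instance Definition _ := isMeasure.Build _ _ _ lebesgue_step
  lebesgue_step0 lebesgue_step_ge0 lebesgue_step_sigma_additive.

Let lebesgue_step_sigma_finite : sigma_finite setT lebesgue_step.
Proof.
have /sigma_finiteP[F [FT ndF Foo]] := sigma_finiteT (@lebesgue_measure R).
have /sigma_finiteP[G [GT ndG Goo]] := sigma_finiteT mu.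
exists (fun k => @tuncons n @^-1` (F k `*` G k)).
  apply/seteqP; split=> // t _.
  have [j _ Fj] : (\bigcup_k F k) (tuncons t).1 by rewrite -FT.
  have [k _ Gk] : (\bigcup_k G k) (tuncons t).2 by rewrite -GT.
  exists (maxn j k) => //; split.
  - by move: Fj; exact/subsetPset/ndF/leq_maxl.
  - by move: Gk; exact/subsetPset/ndG/leq_maxr.
move=> k; have [mF Fk] := Foo k; have [mG Gk] := Goo k; split.
  rewrite -[X in measurable X]setTI.
  by apply: measurable_tuncons => //; exact: measurableX.
rewrite /lebesgue_step /pushforward -comp_preimage.
rewrite (_ : _ \o _ = id); last by apply/funext; exact: tconsK.
by rewrite product_measure1E// lte_mul_pinfty// ge0_fin_numE.
Qed.

HB.instance Definition _ := Measure_isSigmaFinite.Build _ _ _ lebesgue_step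
  lebesgue_step_sigma_finite.

End step.

(* The n-fold product of the one-dimensional Lebesgue measure; R^0 is a point
   of mass 1. *)
Fixpoint lebesgue_tuple (n : nat)
    : {sigma_finite_measure set (n.-tuple T) -> \bar R} :=
  match n with
  | 0 => [the {sigma_finite_measure set (0.-tuple T) -> \bar R} of
          \d_([tuple] : 0.-tuple T)]
  | m.+1 => [the {sigma_finite_measure set (m.+1.-tuple T) -> \bar R} of
             lebesgue_step (lebesgue_tuple m)]
  end.

End lebesgue_on_tuples.

Section distributions.
Variables (R : realType) (n : nat).
Implicit Types (f g phi psi : 'rV[R]_n -> R) (x y : 'rV[R]_n).

Definition integralRn f : R :=
  \int[lebesgue_tuple R n]_t f (\row_(i < n) tnth t i).

Definition partial (i : 'I_n) f : 'rV[R]_n -> R :=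
  fun x => 'D_(delta_mx 0 i) f x.

(* Multi-indices are lists of coordinates, so all orders of differentiation are
   covered. *)
Definition partials (s : seq 'I_n) f : 'rV[R]_n -> R := foldr partial f s.

Definition laplacian f : 'rV[R]_n -> R :=
  fun x => \sum_(i < n) partials [:: i; i] f x.

Definition smooth f : Prop :=
  forall s : seq 'I_n, continuous (partials s f) /\
    forall (i : 'I_n) x, derivable (partials s f) x (delta_mx 0 i).

Definition tsupport f : set 'rV[R]_n := closure [set x | f x != 0].

Definition test_function : set ('rV[R]_n -> R) :=
  [set phi | smooth phi /\ compact (tsupport phi)].

(* Convergence in D(R^n): a common compact set containing all the supports and
   uniform convergence of all partial derivatives. *)
Definition test_cvg (phi_ : nat -> 'rV[R]_n -> R) phi : Prop :=
  (exists K : set 'rV[R]_n, compact K /\ forall k, tsupport (phi_ k) `<=` K) /\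
  forall s : seq 'I_n,
    {uniform, (fun k => partials s (phi_ k)) @ \oo --> partials s phi}.

(* The functional is total on functions R^n -> R, but it is only constrained,
   and only ever used, on test functions. *)
Record generalized_function := GeneralizedFunction {
  pairing :> ('rV[R]_n -> R) -> R ;
  pairing_linear : forall (a : R) phi psi,
    test_function phi -> test_function psi ->
    pairing (fun x => a * phi x + psi x) = a * pairing phi + pairing psi ;
  pairing_continuous : forall (phi_ : nat -> 'rV[R]_n -> R) phi,
    (forall k, test_function (phi_ k)) -> test_function phi ->
    test_cvg phi_ phi -> pairing (phi_ k) @[k --> \oo] --> pairing phi }.

Definition convolution (u : generalized_function) phi : 'rV[R]_n -> R :=
  fun x => u (fun y => phi (x - y)).

Definition bounded_generalized_function (u : generalized_function) : Prop :=
  forall phi, test_function phi -> bounded_fun (convolution u phi).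

Definition almost_periodic g : Prop :=
  continuous g /\
  forall x_ : nat -> 'rV[R]_n, exists (sigma : nat -> nat) (h : 'rV[R]_n -> R),
    {homo sigma : j k / (j < k)%N} /\
    {uniform, (fun k x => g (x + x_ (sigma k))) @ \oo --> h}.

Definition solves_poisson (u : generalized_function) f : Prop :=
  forall phi, test_function phi ->
    - u (laplacian phi) = integralRn (fun x => f x * phi x).

Definition given_by (u : generalized_function) (v : 'rV[R]_n -> R) : Prop :=
  forall phi, test_function phi ->
    u phi = integralRn (fun x => v x * phi x).

End distributions.

(* Main.v *)
(** An almost periodic [f] is bounded. There are radial test functions [rho] and [psi] with
    [int rho = 1] and [laplacian psi x = 2^n rho (2 x) - rho x]. Put [rho_k x = 2^(kn) rho (2^k x)]
    and define [psi_k] likewise. Rescaling gives [rho_(k+1) - rho_k = 4^(-k) laplacian psi_k], so the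
    equation yields [u * rho_(k+1) - u * rho_k = - 4^(-k) (f * psi_k)], which is [O(4^(-k))] uniformly
    because [psi_k] has constant L^1 norm. Hence the smooth functions [u * rho_k], which are bounded
    by hypothesis, converge uniformly to a bounded continuous [v]. Finally
    [int (u * rho_k) phi = u (rho_k * phi)] (a limit of Riemann sums in D(R^n)), and
    [rho_k * phi] tends to [phi] in D(R^n), so that [u] is given by [v]. *)

Require Import Defs.
From mathcomp Require Import all_boot all_order all_algebra.
From mathcomp Require Import all_classical all_reals all_analysis.
From mathcomp Require Import measurable_realfun ring lra.
Import Order.TTheory GRing.Theory Num.Theory.
Import numFieldNormedType.Exports.
Local Open Scope classical_set_scope.
Local Open Scope ring_scope.

Set Implicit Arguments.
Unset Strict Implicit.
Unset Printing Implicit Defensive.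

(** * Smooth functions of one variable *)

Section one_variable.
Variable R : realType.
Implicit Types (f g : R -> R) (x s a c : R).

(** Boundedness of each [u * phi] says nothing uniform in [phi], so a summable bound on the
    increments of [u * rho_k] has to come from the equation. For this the increment of the
    mollifiers must be the Laplacian of a test function, which vanishing integral alone does not
    ensure: a Laplacian of a test function is orthogonal to every harmonic polynomial. Radial
    symmetry removes that obstruction, since the potential of a radial density of total mass zero is
    constant outside its support. The pair is built backwards: the derivative of [psi] with respect
    to the squared norm is chosen first, supported away from the origin, and [rho] is read off from
    it. The singularity of the fundamental solution then never appears, and the dimensions 1 and 2
    need no separate treatment. The functional [u] is only linear and sequentially continuous, so it
    can be moved past an integral only through finite sums that converge together with all
    derivatives. This is why integration is developed through Riemann sums with explicit errors. *)

Definition flat k x : R := if 0 < x then (x^-1) ^+ k * expR (- x^-1) else 0.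

Lemma is_derive_ext (V W : normedModType R) (h k : V -> W) (x v : V) (dh dk : W) :
  is_derive x v h dh -> h =1 k -> dh = dk -> is_derive x v k dk.
Proof. by move=> H /funext <- <-. Qed.

Lemma flat_ge0 k x : 0 <= flat k x.
Proof.
rewrite /flat; case: ltP => // x0.
by rewrite mulr_ge0 ?expR_ge0 ?exprn_ge0 ?invr_ge0 ?ltW.
Qed.

Lemma exprn_expRN_le k (y : R) : 0 <= y -> y ^+ k.+1 * expR (- y) <= (k.+1)`!%:R.
Proof.
move=> y0; rewrite expRN ler_pdivrMr ?expR_gt0//.
rewrite mulrC -ler_pdivrMr ?ltr0n ?fact_gt0//.
by apply: le_trans (expR_ge1Dxn k y0); rewrite lerDr.
Qed.

(** With [y = x^-1] the quotient by [x ^+ 2] is [y ^+ k.+2 * expR (- y)], and one term of the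
    exponential series bounds it. *)
Lemma flat_le k x : flat k x <= (k.+2)`!%:R * x ^+ 2.
Proof.
rewrite /flat; case: ltP => x0; last by rewrite mulr_ge0 ?sqr_ge0.
rewrite -ler_pdivrMr ?exprn_gt0// -exprVn mulrAC -exprD addn2.
by apply: exprn_expRN_le; rewrite invr_ge0 ltW.
Qed.

(** The powers of [x^-1] close the family under differentiation, up to linear combinations. At [0]
    the difference quotient of [flat k] is [flat k.+1], continuous there by the quadratic bound. *)
Lemma is_derive_flat k x :
  is_derive x 1 (flat k) (flat k.+2 x - k%:R * flat k.+1 x).
Proof.
have [x0|x0|->] := ltgtP x 0.
- rewrite /flat ltNge (ltW x0)/= mulr0 subr0.
  apply: (@near_eq_is_derive _ _ _ (cst 0)).
    near=> y; rewrite /= ltNge ltW//; near: y; exact: lt_nbhsl.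
- apply: (@near_eq_is_derive _ _ _ (fun y : R => (y^-1) ^+ k * expR (- y^-1) : R)).
    near=> y; rewrite /flat ifT//; near: y; exact: lt_nbhsr.
  have x_neq0 : x != 0 by rewrite gt_eqF.
  have dV := is_deriveV x_neq0 (is_derive_id x (1 : R)).
  have dX : is_derive x 1 (fun y : R => y^-1 ^+ k) (k%:R * x^-1 ^+ k.-1 * (- x ^- 2)).
    apply: is_derive_ext (@is_deriveX _ _ _ k x 1 _ dV) _ _ => [y|].
      by rewrite exprfctE.
    by rewrite /GRing.scale /= mulr1.
  have dE : is_derive x 1 (fun y : R => expR (- y^-1)) (expR (- x^-1) * x ^- 2).
    have dN : is_derive x 1 (fun y : R => - y^-1) (x ^- 2).
      apply: is_derive_ext (is_deriveN dV) _ _ => //.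
      by rewrite /GRing.scale/= mulr1 opprK.
    exact: (is_derive1_comp (is_derive_expR _) dN).
  apply: is_derive_ext (is_deriveM dX dE) _ _ => //.
  rewrite /flat x0 /GRing.scale /=.
  case: k {dX} => [|k] /=.
    by rewrite !mul0r mulr0 addr0 subr0 expr0 mul1r exprVn mulrC.
  rewrite !exprVn !exprS !invfM. rewrite expr0 invr1; ring.
- have f0 j : flat j 0 = 0 by rewrite /flat ltxx.
  rewrite !f0 mulr0 subr0; apply/is_derive1_caratheodory.
  exists (flat k.+1); split => //.
    move=> z; rewrite f0 !subr0 /flat; case: ltP => z0; last by rewrite mul0r.
    by rewrite exprS mulrAC -[_^-1 * _ * z]mulrAC mulVf ?gt_eqF// mul1r.
  apply/cvgrPdist_le => e e0; rewrite f0.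
  have C0 : 0 < (k.+3)`!%:R :> R by rewrite ltr0n fact_gt0.
  have d0 := divr_gt0 e0 C0.
  near=> z; rewrite sub0r normrN ger0_norm ?flat_ge0//.
  apply: le_trans (flat_le _ _) _.
  rewrite mulrC -ler_pdivlMr//.
  have z1 : `|z| <= 1 by near: z; apply: (@nbhs0_le _ R^o).
  have zd : `|z| <= e / (k.+3)`!%:R by near: z; apply: (@nbhs0_le _ R^o).
  rewrite -real_normK ?num_real// expr2; apply: le_trans zd; rewrite ler_piMl//.
Unshelve. all: by end_near. Qed.

(* A class of everywhere differentiable functions that is closed under differentiation, whence its
   members are smooth. The vanishing condition keeps [s `^ a] away from its singularity at [0]. *)
Inductive profile : (R -> R) -> Prop :=
| profile_cst c : profile (fun=> c)
| profile_flat k a b : profile (fun s => flat k (a + b * s))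
| profile_add f g : profile f -> profile g -> profile (fun s => f s + g s)
| profile_mul f g : profile f -> profile g -> profile (fun s => f s * g s)
| profile_scale c f : profile f -> profile (fun s => f (c * s))
| profile_powR a c f : 0 < c -> profile f -> (forall s, s < c -> f s = 0) ->
    profile (fun s => s `^ a * f s)
| profile_primitive f F : profile f -> (forall s, is_derive s 1 F (f s)) -> profile F.

Lemma is_derive_affine a b (s : R) : is_derive s 1 (fun t : R => a + b * t) b.
Proof.
have db := is_deriveZ b (is_derive_id s (1 : R)).
apply: is_derive_ext (is_deriveD (is_derive_cst a s (1 : R)) db) _ _ => //.
by rewrite add0r /GRing.scale /= mulr1.
Qed.

Lemma derive_eq0 (f : R -> R) df c s : (forall s, s < c -> f s = 0) -> s < c ->
  is_derive s 1 f df -> df = 0.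
Proof.
move=> f0 sc fs; have : is_derive s (1 : R) (cst 0 : R -> R) df.
  apply: near_eq_is_derive fs; near=> t; rewrite f0//; near: t; exact: lt_nbhsl.
by move=> [_ <-]; exact: derive_cst.
Unshelve. all: by end_near. Qed.

Lemma profile_is_derive f : profile f ->
  exists2 f', profile f' & forall s, is_derive s 1 f (f' s).
Proof.
elim=> {f}.
- by move=> c; exists (fun=> 0); [exact: profile_cst|move=> s; exact: is_derive_cst].
- move=> k a b.
  exists (fun s => b * (flat k.+2 (a + b * s) + (- k%:R) * flat k.+1 (a + b * s))).
    apply: profile_mul; first exact: profile_cst.
    apply: profile_add; first exact: profile_flat.
    by apply: profile_mul; [exact: profile_cst|exact: profile_flat].
  move=> s; have dab := is_derive_affine a b s.
  apply: is_derive_ext (is_derive1_comp (is_derive_flat _ _) dab) _ _ => //.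
  by rewrite mulrC mulNr.
- move=> f g _ [f' f'E df] _ [g' g'E dg]; exists (fun s => f' s + g' s); first exact: profile_add.
  by move=> s; exact: is_deriveD.
- move=> f g fE [f' f'E df] gE [g' g'E dg]; exists (fun s => f s * g' s + g s * f' s).
    by apply: profile_add; apply: profile_mul.
  by move=> s; apply: is_derive_ext (is_deriveM (df s) (dg s)) _ _.
- move=> c f _ [f' f'E df]; exists (fun s => c * f' (c * s)).
    by apply: profile_mul; [exact: profile_cst|exact: profile_scale].
  move=> s; have := is_derive_affine 0 c s.
  under [X in is_derive _ _ X _]eq_fun do rewrite add0r.
  by move=> H; apply: is_derive_ext (is_derive1_comp (df _) H) _ _ => //; rewrite mulrC.
- move=> a c f c0 fE [f' f'E df] f0.
  (* Vanishing below [c] passes to [f'], so both terms of the product rule are again a power times a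
     profile that vanishes below [c]. *)
  have f'0 s : s < c -> f' s = 0 by move=> sc; apply: derive_eq0 f0 sc (df s).
  exists (fun s => a * (s `^ (a - 1) * f s) + s `^ a * f' s).
    apply: profile_add; last exact: profile_powR f'0.
    by apply: profile_mul; [exact: profile_cst|exact: profile_powR f0].
  move=> s; have [s0|sc] := ltP 0 s.
    apply: is_derive_ext (is_deriveM (is_derive1_powR a s0) (df s)) _ _ => //.
    by rewrite /GRing.scale /=; ring.
  have {}sc : s < c by apply: le_lt_trans c0.
  rewrite f0// f'0// !mulr0 addr0.
  apply: (@near_eq_is_derive _ _ _ (cst 0)).
  near=> t; rewrite /= f0 ?mulr0//; near: t; exact: lt_nbhsl.
- by move=> f F fE _ dF; exists f.
Unshelve. all: by end_near. Qed.

Lemma profile_continuous f : profile f -> continuous f.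
Proof.
move=> /profile_is_derive[f' _ df] x; have [H _] := df x.
exact/differentiable_continuous/derivable1_diffP.
Qed.

(** The integral starts at [0], below the threshold [c]: for [s < c] the integrand vanishes on the
    interval, which is empty when [s] is negative. The fundamental theorem is then called only for
    [s > 0]. *)
Lemma profile_ex_primitive c f : profile f -> 0 < c -> (forall s, s < c -> f s = 0) ->
  exists F, [/\ profile F, forall s, is_derive s 1 F (f s) & forall s, s < c -> F s = 0].
Proof.
move=> fE c0 f0; pose F x : R := (\int[lebesgue_measure]_(t in `[0%R, x]) f t)%R.
have F0 s : s < c -> F s = 0.
  move=> sc; rewrite /F (@eq_Rintegral _ _ _ _ _ (cst 0)) ?Rintegral_cst ?mul0r//.
  move=> t; rewrite inE /= in_itv /= => /andP[_ ts].
  by rewrite f0// (le_lt_trans ts).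
have dF s : is_derive s 1 F (f s).
  have [s0|sc] := ltP 0 s; last first.
    have {}sc : s < c by apply: le_lt_trans c0.
    rewrite f0//; apply: (@near_eq_is_derive _ _ _ (cst 0)).
    near=> t; rewrite /= F0//; near: t; exact: lt_nbhsl.
  have s1 : s < s + 1 by rewrite ltrDl.
  have [||] := @continuous_FTC1_closed _ f 0 s _ s1 _ s0.
  - apply: continuous_compact_integrable; first exact: segment_compact.
    exact/continuous_subspaceT/profile_continuous.
  - exact: profile_continuous.
  by move=> dF; rewrite derive1E => <-; exact: DeriveDef.
by exists F; split => //; exact: profile_primitive dF.
Unshelve. all: by end_near. Qed.

End one_variable.

(** * Smooth and test functions *)

Section continuous_real_functions.
Variables (R : realType) (T : topologicalType).
Implicit Types f g : T -> R.

Lemma continuous_add f g : continuous f -> continuous g ->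
  continuous (fun x => f x + g x).
Proof. by move=> cf cg x; exact: (cvgD (cf x) (cg x)). Qed.

Lemma continuous_mul f g : continuous f -> continuous g ->
  continuous (fun x => f x * g x).
Proof. by move=> cf cg x; exact: (cvgM (cf x) (cg x)). Qed.

Lemma continuous_mull (a : R) f : continuous f -> continuous (fun x => a * f x).
Proof. by apply: continuous_mul => x; exact: cvg_cst. Qed.

Lemma continuous_sumr (I : Type) (r : seq I) (F : I -> T -> R) :
  (forall i, continuous (F i)) -> continuous (fun x => \sum_(i <- r) F i x).
Proof.
move=> cF; elim: r => [|i r IH].
  by under [X in continuous X]eq_fun do rewrite big_nil; move=> x; exact: cvg_cst.
under [X in continuous X]eq_fun do rewrite big_cons.
exact: continuous_add.
Qed.

End continuous_real_functions.

Section directional_derivatives.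
Variables (R : realType) (V : normedModType R).
Implicit Types (f : V -> R) (x y v : V).

Lemma is_deriveE (W : normedModType R) (f : V -> W) x v d :
  is_derive x v f d -> 'D_v f x = d.
Proof. by case. Qed.

(** Both sides have the same difference quotients. Restriction to lines transfers the one-variable
    chain rule and mean value theorem to directional derivatives. *)
Lemma is_derive_line f x v (t d : R) :
  is_derive (t *: v + x) v f d <-> is_derive t 1 (fun h => f (h *: v + x)) d.
Proof.
have E : (fun h : R => h^-1 *: ((f \o shift (t *: v + x)) (h *: v) - f (t *: v + x)))
       = (fun h : R => h^-1 *: (((fun h => f (h *: v + x)) \o shift t) (h *: 1) - f (t *: v + x))).
  by apply/funext => h /=; rewrite addrA -scalerDl [_%:A]mulr1.
split=> -[H1 H2]; split.
- by rewrite /derivable -E.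
- by rewrite -H2 /derive E.
- by rewrite /derivable E.
- by rewrite -H2 /derive -E.
Qed.

Lemma is_derive_line0 f x v (d : R) :
  is_derive x v f d <-> is_derive (0 : R) 1 (fun h => f (h *: v + x)) d.
Proof. by rewrite -is_derive_line scale0r add0r. Qed.

Lemma is_derive_compR (f : R -> R) (g : V -> R) x v a b :
  is_derive (g x) 1 f a -> is_derive x v g b ->
  is_derive x v (fun y => f (g y)) (a * b).
Proof.
move=> df /is_derive_line0 dg; apply/is_derive_line0.
apply: (is_derive1_comp (f := f) (g := fun h => g (h *: v + x))) dg.
by rewrite scale0r add0r.
Qed.

Lemma is_derive_comp_affine f (c : R) b x v d :
  is_derive (c *: x + b) v f d ->
  is_derive x v (fun y => f (c *: y + b)) (c * d).
Proof.
move=> /is_derive_line0 df; apply/is_derive_line0.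
have := is_derive_affine 0 c (0 : R).
move=> /(@is_derive1_comp _ (fun h => f (h *: v + (c *: x + b)))) H.
have := H d; rewrite mulr0 addr0 => /(_ df) {}H.
apply: is_derive_ext H _ _ => [h /=|]; last by rewrite mulrC.
by rewrite add0r addrA scalerDr scalerA.
Qed.

End directional_derivatives.

(** * Compact support and uniform continuity *)

Section compact_support.
Variables (R : realType) (n : nat).
Implicit Types (f g phi psi : 'rV[R]_n -> R) (x y : 'rV[R]_n).

(** Compact support as used throughout: a radius for the sup norm of ['rV[R]_n], which can be
    tracked through operations. *)
Definition vanishes_off (M : R) f := forall x, M < `|x| -> f x = 0.

Lemma coord_le_norm x (i : 'I_n) : `|x 0 i| <= `|x|.
Proof. by rewrite [leRHS]/Num.norm /= mx_normrE; apply/bigmax_geP; right; exists (0, i). Qed.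

Lemma norm_le_coord x (r : R) : 0 <= r -> (forall i, `|x 0 i| <= r) -> `|x| <= r.
Proof.
move=> r0 xr; rewrite [leLHS]/Num.norm /= mx_normrE; apply/bigmax_leP.
by split=> // -[j i] _; rewrite ord1.
Qed.

Lemma compact_cball (M : R) : compact [set x : 'rV[R]_n | `|x| <= M].
Proof.
apply: bounded_closed_compact.
  by exists M; split; rewrite ?num_real// => N MN x /= /le_trans; apply; exact: ltW.
have -> : [set x : 'rV[R]_n | `|x| <= M] = (fun x => `|x|) @^-1` [set r : R | r <= M].
  by [].
by apply: closed_comp => [x _|]; [exact: norm_continuous|exact: closed_le].
Qed.

Lemma compact_tsupportP f : compact (tsupport f) <-> exists M, vanishes_off M f.
Proof.
split=> [/compact_bounded[M [_ HM]]|[M HM]].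
  exists (M + 1) => x; apply: contraTeq => fx; rewrite -leNgt.
  apply: HM; first by rewrite ltrDl.
  exact: subset_closure.
apply: (subclosed_compact _ (@compact_cball M)); first exact: closed_closure.
rewrite /tsupport closureE; apply: smallest_sub.
  by apply: compact_closed; [exact: norm_hausdorff|exact: compact_cball].
by move=> x /= fx; rewrite leNgt; apply: contra fx => /HM ->.
Qed.

(** Heine-Cantor on the ball of radius [M + 1]. As [d <= 1], a point outside that ball has all its
    [d]-neighbours outside the ball of radius [M], so both values vanish. *)
Lemma uniformly_continuous f M (e : R) : continuous f -> vanishes_off M f -> 0 < e ->
  exists2 d, 0 < d & forall x y, `|x - y| <= d -> `|f x - f y| <= e.
Proof.
move=> cf fM e0.
pose P (d : R) x := forall y, `|x - y| <= d -> `|f x - f y| <= e.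
have : \forall d \near (0 : R)^'+, [set x : 'rV[R]_n | `|x| <= M + 1] `<=` P d.
  have /compact_near_coveringP := @compact_cball (M + 1).
  apply => x _.
  have e2 : 0 < e / 2 by rewrite divr_gt0.
  have /cvgrPdist_le/(_ _ e2)/nbhs_normP[r /= r0 Hr] := cf x.
  have r2 : 0 < r / 2 by rewrite divr_gt0.
  exists (ball x (r / 2), [set d | d < r / 2]) => /=.
    split; first exact: nbhsx_ballx.
    exact: nbhs_right_lt.
  move=> [x' d] /= [xx' dr] y x'y.
  rewrite -ball_normE /= in xx'.
  rewrite -(subrK (f x) (f x')) -addrA (splitr e).
  apply: le_trans (ler_normD _ _) _; rewrite lerD//.
    rewrite distrC; apply: Hr => /=; apply: lt_trans xx' _.
    by rewrite ltr_pdivrMr// ltr_pMr// ltr1n.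
  apply: Hr => /=; rewrite -(subrK x' x) -addrA (splitr r).
  by apply: le_lt_trans (ler_normD _ _) _; rewrite ltrD// (le_lt_trans x'y).
move=> H; have [d [d0 d1 Hd]] : exists d : R,
    [/\ 0 < d, d <= 1 & [set x : 'rV[R]_n | `|x| <= M + 1] `<=` P d].
  near (0 : R)^'+ => d; exists d; split; near: d => //.
    exact: nbhs_right_gt.
  exact: nbhs_right_le.
exists d => // x y xy; have [/Hd|Mx] := leP `|x| (M + 1); first exact.
have My : M < `|y|.
  have : `|x| <= `|y| + 1.
    rewrite -(subrK y x) addrC; apply: le_trans (ler_normD _ _) _.
    by rewrite lerD2l (le_trans xy).
  lra.
by rewrite !fM ?subrr ?normr0 ?ltW//; apply: lt_trans Mx; rewrite ltrDl.
Unshelve. all: by end_near. Qed.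

Lemma bounded_vanishes_off f M : continuous f -> vanishes_off M f ->
  exists2 B, 0 < B & forall x, `|f x| <= B.
Proof.
move=> cf fM.
have /compact_bounded[B [_ HB]] : compact (f @` [set x | `|x| <= M]).
  by apply: continuous_compact (@compact_cball M); exact: continuous_subspaceT.
exists (`|B| + 1); first by rewrite ltr_wpDl.
move=> x; have [xM|/fM ->] := leP `|x| M; last by rewrite normr0 addr_ge0.
apply: HB; last by exists x.
by rewrite (le_lt_trans (ler_norm _))// ltrDl.
Qed.

End compact_support.

(** * Partial derivatives of all orders and test functions *)

Section smooth_functions.
Variables (R : realType) (n : nat).
Implicit Types (f g phi psi : 'rV[R]_n -> R) (x y b : 'rV[R]_n) (s : seq 'I_n).

Lemma smooth_continuous f : smooth f -> continuous f.
Proof. by move=> /(_ [::])[]. Qed.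

Lemma smooth_partials s f : smooth f -> smooth (partials s f).
Proof. by move=> fS t; rewrite /partials -foldr_cat; exact: fS. Qed.

Lemma smooth_is_derive i f x : smooth f ->
  is_derive x (delta_mx 0 i) f (partial i f x).
Proof. by move=> /(_ [::])[_ /(_ i x)] /derivableP. Qed.

(** Iterated partial derivatives never leave [C]. Smoothness is thus reduced to exhibiting a class
    stable under first partial derivatives, without a formula for the higher ones. *)
Lemma smooth_coind (C : set ('rV[R]_n -> R)) :
  (forall f, C f -> continuous f /\ forall i : 'I_n,
     exists2 f', C f' & forall x, is_derive x (delta_mx 0 i) f (f' x)) ->
  forall f, C f -> smooth f.
Proof.
move=> HC f Cf s; have CE g i : C g -> C (partial i g).
  move=> /HC[_ /(_ i)[g' Cg' dg]]; suff -> : partial i g = g' by [].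
  by apply/funext => x; exact: is_deriveE.
have /HC[cfs dfs] : C (partials s f) by elim: s => //= i s; exact: CE.
by split=> // i x; have [f' _ /(_ x)[]] := dfs i.
Qed.

Lemma partials_linear s (a : R) f g : smooth f -> smooth g ->
  partials s (fun x => a * f x + g x) = (fun x => a * partials s f x + partials s g x).
Proof.
move=> fS gS; elim: s => //= i s ->; apply/funext => x.
have df := smooth_is_derive i x (smooth_partials s fS).
have dg := smooth_is_derive i x (smooth_partials s gS).
exact: (is_deriveE (is_deriveD (is_deriveZ a df) dg)).
Qed.

Lemma smooth_linear (a : R) f g : smooth f -> smooth g ->
  smooth (fun x => a * f x + g x).
Proof.
move=> fS gS; apply: (@smooth_coind [set h | exists f g,
    [/\ smooth f, smooth g & h = fun x => a * f x + g x]]); last first.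
  by exists f, g.
move=> _ [f1 [g1 [f1S g1S ->]]]; split=> [|i].
  by apply: continuous_add; [apply: continuous_mull|]; exact: smooth_continuous.
exists (fun x => a * partial i f1 x + partial i g1 x).
  exists (partial i f1), (partial i g1); split; last by [].
    exact: (@smooth_partials [:: i] _ f1S).
  exact: (@smooth_partials [:: i] _ g1S).
move=> x; have df := is_deriveZ a (smooth_is_derive i x f1S).
exact: (is_deriveD df (smooth_is_derive i x g1S)).
Qed.

Lemma smooth_cst (c : R) : smooth (fun _ : 'rV[R]_n => c).
Proof.
apply: (@smooth_coind [set h | exists c, h = fun=> c]); last by exists c.
move=> _ [{}c ->]; split=> [x|i]; first exact: cst_continuous.
by exists (fun=> 0); [exists 0|move=> x; exact: is_derive_cst].
Qed.

Lemma partials_cst0 s : partials s (fun _ : 'rV[R]_n => 0 : R) = fun=> 0.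
Proof.
elim: s => //= i s ->; apply/funext => x; exact: derive_cst.
Qed.

Lemma partials_affine s (c : R) b f : smooth f ->
  partials s (fun y => f (c *: y + b)) =
  (fun y => c ^+ size s * partials s f (c *: y + b)).
Proof.
move=> fS; elim: s => [|i s IH] /=; first by under [RHS]eq_fun do rewrite expr0 mul1r.
rewrite IH; apply/funext => x.
have df := smooth_is_derive i (c *: x + b) (smooth_partials s fS).
have dg := is_deriveZ (c ^+ size s) (is_derive_comp_affine df).
have := is_deriveE dg; rewrite /partial => ->.
by rewrite /GRing.scale /= exprS mulrA [c * _]mulrC.
Qed.

Lemma affine_continuous (c : R) b : continuous (fun y : 'rV[R]_n => c *: y + b).
Proof.
by move=> x; exact: (cvgD (@scaler_continuous  _ _ c x) (cvg_cst b)).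
Qed.

Lemma smooth_affine (c : R) b f : smooth f -> smooth (fun y => f (c *: y + b)).
Proof.
move=> fS s; rewrite partials_affine//; split=> [|i x].
  apply: continuous_mull => x.
  apply: (continuous_comp (f := fun y => c *: y + b)); first exact: affine_continuous.
  exact/smooth_continuous/smooth_partials.
have df := smooth_is_derive i (c *: x + b) (smooth_partials s fS).
have dg := is_deriveZ (c ^+ size s) (is_derive_comp_affine df).
by case: dg.
Qed.

Lemma laplacian_affine (c : R) b f : smooth f ->
  laplacian (fun y => f (c *: y + b)) = (fun y => c ^+ 2 * laplacian f (c *: y + b)).
Proof.
move=> fS; apply/funext => y; rewrite /laplacian mulr_sumr.
by apply: eq_bigr => i _; rewrite partials_affine.
Qed.

(** The condition on [x] is open, so the function is zero around [x]; the radius does not grow. *)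
Lemma vanishes_off_partials s f M : vanishes_off M f -> vanishes_off M (partials s f).
Proof.
move=> fM; elim: s => //= i s IH x Mx.
have : is_derive x (delta_mx 0 i) (partials s f) 0.
  apply: near_eq_is_derive (is_derive_cst (0 : R) x (delta_mx 0 i)).
  have : nbhs x [set y : 'rV[R]_n | M < `|y|].
    apply: (@open_nbhs_nbhs _ x); split => //.
    have -> : [set x : 'rV[R]_n | M < `|x| ] =
      (fun x => `|x|) @^-1` [set r : R | M < r] by [].
    by apply: open_comp => [y _|]; [exact: norm_continuous|exact: open_gt].
  by apply: filterS => y /= My; rewrite IH.
exact: is_deriveE.
Qed.

Lemma test_functionP f : test_function f <-> smooth f /\ exists M, vanishes_off M f.
Proof. by rewrite /test_function/=; split=> -[fS /compact_tsupportP]. Qed.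

Lemma test_function_linear (a : R) phi psi : test_function phi -> test_function psi ->
  test_function (fun x => a * phi x + psi x).
Proof.
move=> /test_functionP[fS [M fM]] /test_functionP[gS [N gN]].
apply/test_functionP; split; first exact: smooth_linear.
exists (Num.max M N) => x; rewrite gt_max => /andP[Mx Nx].
by rewrite fM// gN// mulr0 addr0.
Qed.

Lemma test_function0 : test_function (fun _ : 'rV[R]_n => 0 : R).
Proof. by apply/test_functionP; split; [exact: smooth_cst|exists 0]. Qed.

Lemma vanishes_off_affine (c : R) b f M : c != 0 -> vanishes_off M f ->
  vanishes_off (`|c|^-1 * (M + `|b|)) (fun y => f (c *: y + b)).
Proof.
move=> c0 fM y; rewrite -ltr_pdivlMl ?invr_gt0 ?normr_gt0// invrK -normrZ => My.
apply: fM; rewrite -ltrBrDr in My => //.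
apply: lt_le_trans My _; rewrite -{1}(addrK b (c *: y)).
by rewrite lerBlDr; exact: ler_normB.
Qed.

Lemma test_function_affine (c : R) b phi : c != 0 -> test_function phi ->
  test_function (fun y => phi (c *: y + b)).
Proof.
move=> c0 /test_functionP[fS [M fM]]; apply/test_functionP; split.
  exact: smooth_affine.
by eexists; exact: vanishes_off_affine fM.
Qed.

Lemma test_function_scale (a : R) phi : test_function phi ->
  test_function (fun x => a * phi x).
Proof.
move=> fT; have := test_function_linear a fT test_function0.
by under eq_fun do rewrite addr0.
Qed.

Lemma sum_test_function (I : Type) (r : seq I) (a : I -> R) (F : I -> 'rV[R]_n -> R) :
  (forall i, test_function (F i)) ->
  test_function (fun x => \sum_(i <- r) a i * F i x).
Proof.
move=> FT; elim: r => [|i r IH].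
  by under eq_fun do rewrite big_nil; exact: test_function0.
by under eq_fun do rewrite big_cons; exact: test_function_linear.
Qed.

Lemma partials_sum (I : Type) (r : seq I) (a : I -> R) (F : I -> 'rV[R]_n -> R) s :
  (forall i, test_function (F i)) ->
  partials s (fun x => \sum_(i <- r) a i * F i x) =
  (fun x => \sum_(i <- r) a i * partials s (F i) x).
Proof.
move=> FT; elim: r => [|i r IH].
  under eq_fun do rewrite big_nil; under [RHS]eq_fun do rewrite big_nil.
  exact: partials_cst0.
under eq_fun do rewrite big_cons; under [RHS]eq_fun do rewrite big_cons.
rewrite partials_linear ?IH//; first by have [] := FT i.
by have [] := sum_test_function r a FT.
Qed.

Lemma pairing0 (u : generalized_function R n) : u (fun=> 0) = 0.
Proof.
have := pairing_linear u 1 test_function0 test_function0.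
under [X in u X]eq_fun do rewrite mul1r addr0.
by rewrite mul1r => /eqP; rewrite -subr_eq0 opprD addNKr oppr_eq0 => /eqP.
Qed.

Lemma pairing_sum (u : generalized_function R n) (I : Type) (r : seq I) (a : I -> R)
    (F : I -> 'rV[R]_n -> R) :
  (forall i, test_function (F i)) ->
  u (fun x => \sum_(i <- r) a i * F i x) = \sum_(i <- r) a i * u (F i).
Proof.
move=> FT; have u0 := pairing0 u.
elim: r => [|i r IH].
  by under [X in u X]eq_fun do rewrite big_nil; rewrite big_nil.
under [X in u X]eq_fun do rewrite big_cons; rewrite big_cons -IH.
by apply: pairing_linear => //; exact: sum_test_function.
Qed.

End smooth_functions.

(** * Radial functions *)

Section radial_functions.
Variables (R : realType) (n : nat).
Implicit Types (f g phi psi : 'rV[R]_n -> R) (x y b : 'rV[R]_n) (s : seq 'I_n).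

(** The squared Euclidean norm, not the square of the sup norm; being polynomial, it keeps radial
    functions smooth at the origin. *)
Definition sqn x : R := \sum_(i < n) x 0 i ^+ 2.

(** A partial derivative of a radial function carries a factor [x 0 i], so radial functions alone
    are not stable. The algebra they generate with the coordinates is, and [smooth_coind] applies to
    it. *)
Inductive radial_class : ('rV[R]_n -> R) -> Prop :=
| radial_radial h : profile h -> radial_class (fun x => h (sqn x))
| radial_coord (i : 'I_n) : radial_class (fun x => x 0 i)
| radial_cst c : radial_class (fun=> c)
| radial_add f g : radial_class f -> radial_class g -> radial_class (fun x => f x + g x)
| radial_mul f g : radial_class f -> radial_class g -> radial_class (fun x => f x * g x).

Lemma is_derive_coord (i : 'I_n) x (v : 'rV[R]_n) : is_derive x v (fun x => x 0 i) (v 0 i).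
Proof.
apply/is_derive_line0; have := is_derive_affine (x 0 i) (v 0 i) 0.
move=> H; apply: is_derive_ext H _ _ => // h; by rewrite !mxE addrC mulrC.
Qed.

Lemma is_derive_sqn (i : 'I_n) x : is_derive x (delta_mx 0 i) sqn (2 * x 0 i).
Proof.
have H (j : 'I_n) := is_deriveX 2 (is_derive_coord j x (delta_mx 0 i)).
apply: is_derive_ext (is_derive_sum H) _ _ => [y|].
  by rewrite /sqn fct_sumE; apply: eq_bigr => j _.
rewrite (bigD1 i)//= big1 ?addr0 => [|j ji].
  by rewrite !mxE !eqxx /GRing.scale /= mulr1 expr1.
by rewrite !mxE eqxx (negbTE ji) /GRing.scale /= mulr0.
Qed.

Lemma radial_smooth f : radial_class f -> smooth f.
Proof.
apply: smooth_coind => {}f fC; split.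
  have ccoord (i : 'I_n) : continuous (fun x => x 0 i : R) by exact: coord_continuous.
  elim: fC => {f} [h hE|//|c|f g _ cf _ cg|f g _ cf _ cg].
  - move=> x; apply: (continuous_comp (f := sqn)); last exact: profile_continuous.
    apply: continuous_sumr => i.
    exact: (continuous_mul (ccoord i) (ccoord i)).
  - exact: cst_continuous.
  - exact: continuous_add.
  - exact: continuous_mul.
move=> i; elim: fC => {f}
  [h hE|j|c|f g fC [f' f'C df] gC [g' g'C dg]|f g fC [f' f'C df] gC [g' g'C dg]].
- have [h' h'E dh] := profile_is_derive hE.
  exists (fun x => h' (sqn x) * (2 * x 0 i)); last first.
    by move=> x; exact: is_derive_compR (dh _) (is_derive_sqn i x).
  apply: radial_mul; first exact: radial_radial.
  by apply: radial_mul; [exact: radial_cst|exact: radial_coord].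
- exists (fun=> (delta_mx 0 i : 'rV[R]_n) 0 j); first exact: radial_cst.
  by move=> x; exact: is_derive_coord.
- by exists (fun=> 0); [exact: radial_cst|move=> x; exact: is_derive_cst].
- by exists (fun x => f' x + g' x); [exact: radial_add|move=> x; exact: is_deriveD].
- exists (fun x => f x * g' x + g x * f' x).
    by apply: radial_add; exact: radial_mul.
  by move=> x; exact: is_deriveM.
Qed.

Lemma laplacian_radial (h h1 h2 : R -> R) :
  (forall t : R, is_derive t 1 h (h1 t)) -> (forall t : R, is_derive t 1 h1 (h2 t)) ->
  laplacian (fun x => h (sqn x)) =
  (fun x => 4 * sqn x * h2 (sqn x) + 2 * n%:R * h1 (sqn x)).
Proof.
move=> dh dh1; apply/funext => x; rewrite /laplacian.
transitivity (\sum_(i < n) (4 * h2 (sqn x) * x 0 i ^+ 2 + 2 * h1 (sqn x))).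
  apply: eq_bigr => i _ /=.
  have -> : partial i (fun x => h (sqn x)) = fun x => h1 (sqn x) * (2 * x 0 i).
    by apply/funext => y; exact: is_deriveE (is_derive_compR (dh _) (is_derive_sqn i y)).
  have d1 := is_derive_compR (dh1 _) (is_derive_sqn i x).
  have d2 := is_deriveZ 2 (is_derive_coord i x (delta_mx 0 i)).
  rewrite /partial (is_deriveE (is_deriveM d1 d2)).
  rewrite /GRing.scale /= mxE !eqxx -[2 *: _]/(2 * _) /= expr2; ring.
rewrite big_split /= -mulr_sumr sumr_const card_ord -mulr_natl -/(sqn x); ring.
Qed.

Lemma sqr_norm_le_sqn x : `|x| ^+ 2 <= sqn x.
Proof.
have [->|x0] := eqVneq x 0.
  by rewrite normr0 expr0n /= sumr_ge0// => i _; exact: sqr_ge0.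
have /(@mx_norm_neq0 _ _ _ x)[[j i] ] : `|x| != 0 by rewrite normr_eq0.
rewrite /Num.norm /= => ->; rewrite ord1 /sqn (bigD1 i)//= real_normK ?num_real//.
by rewrite lerDl sumr_ge0// => k _; exact: sqr_ge0.
Qed.

Lemma sqnZ (c : R) x : sqn (c *: x) = c ^+ 2 * sqn x.
Proof. by rewrite /sqn mulr_sumr; apply: eq_bigr => i _; rewrite mxE exprMn. Qed.

End radial_functions.

(** * Integration over R^n by Riemann sums *)

Section cubes.
Variable R : realType.
Local Notation T := (measurableTypeR R).

(** Half-open, so that the cells of a subdivision partition the cube. *)
Definition cube (n : nat) (a : 'I_n -> R) (h : R) : set (n.-tuple T) :=
  [set t | forall i, a i <= tnth t i < a i + h].

Lemma measurable_cube n (a : 'I_n -> R) h : measurable (cube a h).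
Proof.
have -> : cube a h =
    \bigcap_(i in setT) ((fun t : n.-tuple T => tnth t i) @^-1` `[a i, (a i + h)[).
  apply/seteqP; split=> t /= H i; first by rewrite /= in_itv/=.
  by have := H i I; rewrite /= in_itv.
apply: fin_bigcap_measurable; first exact: finite_finset.
move=> i _; rewrite -[X in measurable X]setTI.
by apply: measurable_tnth => //; exact: measurable_itv.
Qed.

Lemma lebesgue_cube n (a : 'I_n -> R) h : 0 <= h ->
  lebesgue_tuple R n (cube a h) = (h ^+ n)%:E.
Proof.
move=> h0; elim: n a => [|n IH] a.
  rewrite expr0 /= /dirac /= indicE mem_set//.
  by case.
rewrite /= /lebesgue_step /pushforward.
have -> : @tcons R n @^-1` cube a h =
    `[a ord0, (a ord0 + h)[%classic `*` cube (fun i => a (lift ord0 i)) h.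
  apply/seteqP; split=> -[x t] /=.
    move=> H; split; first by have := H ord0; rewrite in_itv.
    move=> i; have := H (lift ord0 i); by rewrite /= tnthS.
  move=> [x0 tH] i; case: (unliftP ord0 i) => [j ->|->]; last by move: x0; rewrite in_itv.
  by rewrite tnthS; exact: tH.
rewrite product_measure1E//; last exact: measurable_cube.
rewrite IH [X in (X * _)%E](_ : _ = h%:E) ?exprS ?EFinM//.
apply: (etrans (lebesgue_measure_itv `[a ord0, (a ord0 + h)[)) => /=.
rewrite lte_fin ltrDl; case: ltP => hh; first by rewrite -EFinD addrAC subrr add0r.
by congr EFin; apply/eqP; rewrite eq_le h0 hh.
Qed.

Lemma integrable_indic_cube n (a : 'I_n -> R) h :
  (lebesgue_tuple R n).-integrable setT (EFin \o \1_(cube a h)).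
Proof.
apply/integrableP; split.
  by apply/measurable_EFinP; apply: measurable_indic; exact: measurable_cube.
rewrite (eq_integral (fun t => (\1_(cube a h) t)%:E)); last first.
  by move=> t _ /=; rewrite ger0_norm.
rewrite integral_indic//; last exact: measurable_cube.
rewrite setIT; have [h0|h0] := leP 0 h.
  by rewrite [X in (X < _)%E](_ : _ = (h ^+ n)%:E) ?ltry//; exact: lebesgue_cube.
(* A negative edge gives the empty cube, except in dimension [0], where the condition is void and
   the cube is the whole one-point space. *)
case: n a => [|n] a.
  rewrite /= /dirac /= indicE mem_set ?ltry//.
  by case.
rewrite [cube _ _](_ : _ = set0) ?measure0 ?ltry//.
by apply/seteqP; split=> t //= /(_ ord0); lra.
Qed.

End cubes.

(** * Riemann sums of continuous functions supported in a cube *)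

Section riemann_sums.
Variables (R : realType) (n : nat).
Local Notation T := (measurableTypeR R).
Local Notation mu := (lebesgue_tuple R n).
Implicit Types (F G : 'rV[R]_n -> R) (a x y : 'rV[R]_n) (L e : R) (N : nat).

Definition row_of (t : n.-tuple T) : 'rV[R]_n := \row_(i < n) tnth t i.

Definition supported_in a L F := forall x, F x != 0 -> forall i, a 0 i <= x 0 i < a 0 i + L.

Definition node a L N (j : {ffun 'I_n -> 'I_N}) : 'rV[R]_n :=
  \row_i (a 0 i + L / N%:R * (j i)%:R).

Definition riemann_sum a L N F : R :=
  \sum_(j : {ffun 'I_n -> 'I_N}) (L / N%:R) ^+ n * F (node a L j).

(** The step function whose integral is the Riemann sum; measurability and error estimates reach [F]
    through it. *)
Let step a L N F (t : n.-tuple T) : R :=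
  \sum_(j : {ffun 'I_n -> 'I_N}) F (node a L j) * \1_(cube (node a L j 0) (L / N%:R)) t.

Lemma supported_in_vanishes_off a L F : supported_in a L F -> vanishes_off (`|a| + `|L|) F.
Proof.
move=> sF x; apply: contraTeq => /sF H; rewrite -leNgt.
apply: norm_le_coord; first by rewrite addr_ge0.
move=> i; have := H i => /andP[H1 H2].
have := coord_le_norm a i; rewrite ler_norml => /andP[H3 H4].
rewrite ler_norml; have := ler_norm L; have := normr_ge0 L; lra.
Qed.

(** The extra [1] lets a half-open cube contain the closed ball and keeps the edge positive when
    [M = 0]. *)
Lemma vanishes_off_supported_in M F : 0 <= M -> vanishes_off M F ->
  supported_in (const_mx (- M)) (2 * M + 1) F.
Proof.
move=> M0 FM x; apply: contraNP => /existsNP[i H]; apply/eqP/FM.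
rewrite ltNge; apply/negP => xM; apply: H; rewrite mxE.
have := coord_le_norm x i; rewrite ler_norml => /andP[H3 H4]; lra.
Qed.

Lemma step_node a L N t (j : {ffun 'I_n -> 'I_N}) F :
  cube (node a L j 0) (L / N%:R) t -> step a L N F t = F (node a L j).
Proof.
move=> tj; rewrite /step (bigD1 j)//= indicE mem_set// mulr1 big1 ?addr0// => k kj.
rewrite indicE memNset ?mulr0// => tk; move/eqP: kj; apply; apply/ffunP => i; apply/val_inj.
have := tk i; have := tj i; rewrite !mxE; set h := L / N%:R.
move=> /andP[A1 A2] /andP[B1 B2].
have h0 : 0 < h by lra.
have : h * (j i)%:R < h * (k i).+1%:R by rewrite -natr1 mulrDr mulr1; lra.
have : h * (k i)%:R < h * (j i).+1%:R by rewrite -natr1 mulrDr mulr1; lra.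
rewrite !ltr_pM2l// !ltr_nat !ltnS => kj jk.
by apply/eqP; rewrite eqn_leq kj jk.
Qed.

Lemma step_out a L N t F : ~ cube (a 0) L t -> (0 < N)%N -> step a L N F t = 0.
Proof.
move=> tL N0; rewrite /step big1// => j _; rewrite indicE memNset ?mulr0// => tj.
apply: tL => i; have := tj i; rewrite mxE; set h := L / N%:R => /andP[A1 A2].
have h0 : 0 < h by lra.
have hL : h * N%:R = L by rewrite divfK// pnatr_eq0 -lt0n.
have : h * (j i).+1%:R <= h * N%:R by rewrite ler_pM2l// ler_nat.
rewrite hL -natr1 mulrDr mulr1.
have : 0 <= h * (j i)%:R by rewrite mulr_ge0// ltW.
lra.
Qed.

Lemma cube_node a L N t : cube (a 0) L t -> (0 < N)%N -> 0 < L ->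
  exists j : {ffun 'I_n -> 'I_N}, cube (node a L j 0) (L / N%:R) t.
Proof.
move=> tL N0 L0; set h := L / N%:R; have h0 : 0 < h by rewrite divr_gt0 ?ltr0n.
have hL : h * N%:R = L by rewrite divfK// pnatr_eq0 -lt0n.
(* The cell containing [t] has as index in direction [i] the integer part of the offset measured in
   mesh units. *)
have Hi (i : 'I_n) : (Num.truncn ((tnth t i - a 0 i) / h)%R < N)%N.
  have /andP[t1 t2] := tL i.
  have /truncn_itv/andP[H _] : 0 <= (tnth t i - a 0 i) / h.
    by rewrite divr_ge0 ?subr_ge0// ltW.
  rewrite -(ltr_nat R); apply: le_lt_trans H _.
  by rewrite ltr_pdivrMr// mulrC hL; lra.
exists [ffun i => Ordinal (Hi i)] => i; rewrite !mxE ffunE /=.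
have /andP[t1 t2] := tL i.
have /truncn_itv : 0 <= (tnth t i - a 0 i) / h.
  by rewrite divr_ge0 ?subr_ge0// ltW.
rewrite ler_pdivlMr// ltr_pdivrMr// -/h; move: (Num.truncn _) => k.
rewrite -natr1 mulrDl mul1r [h * _]mulrC; lra.
Qed.

Lemma step_approx a L N F e t : (0 < N)%N -> 0 < L -> supported_in a L F ->
  (forall x y, `|x - y| <= L / N%:R -> `|F x - F y| <= e) ->
  `|F (row_of t) - step a L N F t| <= e * \1_(cube (a 0) L) t.
Proof.
move=> N0 L0 sF Fe; have h0 : 0 < L / N%:R by rewrite divr_gt0 ?ltr0n.
have [tL|tL] := pselect (cube (a 0) L t).
  rewrite indicE mem_set// mulr1.
  have [j tj] := cube_node tL N0 L0.
  rewrite (step_node _ tj); apply: Fe; apply: norm_le_coord; first exact: ltW.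
  move=> i; have := tj i; rewrite !mxE => /andP[A1 A2]; rewrite ler_norml.
  by move: A1 A2; set h := _ / _; set b := _ + _ * _; lra.
rewrite step_out// indicE memNset// mulr0 subr0.
rewrite [F _](_ : _ = 0) ?normr0//; apply: contrapT => /eqP/sF H.
by apply: tL => i; have := H i; rewrite mxE.
Qed.

Lemma measurable_step a L N F : measurable_fun setT (step a L N F).
Proof.
apply: measurable_sum => j; apply: measurable_funM; first exact: measurable_cst.
by apply: measurable_indic; exact: measurable_cube.
Qed.

Let integrable_step_term a L N F (j : {ffun 'I_n -> 'I_N}) :
  mu.-integrable setT (fun t => (F (node a L j) * \1_(cube (node a L j 0) (L / N%:R)) t)%:E).
Proof.
under eq_fun do rewrite EFinM.
by apply: integrableZl => //; exact: integrable_indic_cube.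
Qed.

Lemma integrable_step a L N F : mu.-integrable setT (EFin \o step a L N F).
Proof.
rewrite (_ : EFin \o _ = fun t => \sum_(j : {ffun 'I_n -> 'I_N})
    (F (node a L j) * \1_(cube (node a L j 0) (L / N%:R)) t)%:E)%E.
  by apply: integrable_sum.
by apply/funext => t /=; rewrite /step sumEFin.
Qed.

Lemma integral_step a L N F : 0 <= L -> (\int[mu]_t step a L N F t)%R = riemann_sum a L N F.
Proof.
move=> L0; have h0 : 0 <= L / N%:R by rewrite divr_ge0.
rewrite /Rintegral (_ : (\int[mu]_t (step a L N F t)%:E)%E = (riemann_sum a L N F)%:E)//.
under eq_integral do rewrite /step -sumEFin.
rewrite integral_sum// /riemann_sum -sumEFin; apply: eq_bigr => j _.
under eq_integral do rewrite EFinM.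
rewrite integralZl//; last exact: integrable_indic_cube.
rewrite [X in _ = EFin X]mulrC EFinM; congr (_ * _)%E.
rewrite integral_indic//; last exact: measurable_cube.
by rewrite setIT; exact: lebesgue_cube.
Qed.

Lemma mesh_modulus a L F e : continuous F -> supported_in a L F -> 0 < e ->
  exists N0, forall N, (N0 <= N)%N -> (0 < N)%N ->
  forall x y, `|x - y| <= L / N%:R -> `|F x - F y| <= e.
Proof.
move=> cF /supported_in_vanishes_off FM e0.
have [d d0 Hd] := uniformly_continuous cF FM e0.
exists (Num.truncn (`|L| / d)).+1 => N N0 N1 x y xy; apply: Hd; apply: le_trans xy _.
rewrite ler_pdivrMr ?ltr0n// -ler_pdivrMl// mulrC.
apply: (@le_trans _ _ (`|L| / d)); first by rewrite ler_pM2r ?invr_gt0// ler_norm.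
by apply: le_trans (ltW (truncnS_gt _)) _; rewrite ler_nat.
Qed.

(** A pointwise limit of step functions on tuples, so no measurable structure on row vectors
    intervenes. *)
Lemma measurable_row_of a L F : 0 < L -> continuous F -> supported_in a L F ->
  measurable_fun setT (fun t => F (row_of t)).
Proof.
move=> L0 cF sF; apply: (@measurable_fun_cvg _ _ _ _ (fun N => step a L N F)).
  by move=> N; exact: measurable_step.
move=> t _; apply/cvgrPdist_le => e e0.
have [N0 HN] := mesh_modulus cF sF e0.
exists (maxn N0 1) => // N /=; rewrite geq_max => /andP[N1 N2].
apply: le_trans (step_approx _ N2 L0 sF (HN _ N1 N2)) _.
by rewrite ler_piMr// ?ltW// indicE; case: (_ \in _).
Qed.

Lemma integrable_row_of a L F : 0 < L -> continuous F -> supported_in a L F ->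
  mu.-integrable setT (EFin \o (fun t => F (row_of t))).
Proof.
move=> L0 cF sF.
have [B B0 FB] := bounded_vanishes_off cF (supported_in_vanishes_off sF).
apply: (@le_integrable _ _ _ _ _ _ _ (fun t => B%:E * (\1_(cube (a 0) L) t)%:E)%E) => //.
- by apply/measurable_EFinP; exact: measurable_row_of sF.
- move=> t _; rewrite -EFinM /= lee_fin [leRHS]ger0_norm; last by rewrite mulr_ge0// ltW.
  rewrite indicE; case: (boolP (t \in _)) => [_|tL]; first by rewrite mulr1; exact: FB.
  rewrite mulr0 [F _](_ : _ = 0) ?normr0//; apply: contrapT => /eqP/sF H.
  by move/negP: tL; apply; rewrite inE => i; have := H i; rewrite mxE.
- by apply: integrableZl => //; exact: integrable_indic_cube.
Qed.

(** The error depends on [F] only through its oscillation at the scale of the mesh; this later gives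
    convergence uniform in a parameter. *)
Lemma riemann_sum_approx a L N F e :
  (0 < N)%N -> 0 < L -> continuous F -> supported_in a L F ->
  (forall x y, `|x - y| <= L / N%:R -> `|F x - F y| <= e) ->
  `|integralRn F - riemann_sum a L N F| <= e * L ^+ n.
Proof.
move=> N0 L0 cF sF Fe.
rewrite -(integral_step _ _ _ (ltW L0)) /integralRn -RintegralB//; last 2 first.
- exact: integrable_row_of sF.
- exact: integrable_step.
have dI : mu.-integrable setT (EFin \o (fun t => F (row_of t) - step a L N F t)).
  apply: (@integrableB _ _ _ _ _ _
    (fun t => (F (row_of t))%:E) (EFin \o step a L N F)) => //.
    exact: integrable_row_of sF.
  exact: integrable_step.
apply: le_trans; first exact: le_normr_Rintegral.
have eI : mu.-integrable setT (EFin \o (fun t => e * \1_(cube (a 0) L) t)).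
  rewrite (_ : _ \o _ = fun t => (e%:E * (\1_(cube (a 0) L) t)%:E)%E)//.
  by apply: integrableZl => //; exact: integrable_indic_cube.
apply: (@le_trans _ _ (\int[mu]_t (e * \1_(cube (a 0) L) t))%R).
  apply: le_Rintegral => //.
  - exact: (integrable_norm dI).
  - move=> t _; exact: step_approx.
rewrite RintegralZl//; last exact: integrable_indic_cube.
rewrite /Rintegral integral_indic ?setIT//; last exact: measurable_cube.
by rewrite [X in fine X](_ : _ = (L ^+ n)%:E)//; apply: lebesgue_cube; exact: ltW.
Qed.

Lemma riemann_sum_cvg a L F : 0 < L -> continuous F -> supported_in a L F ->
  riemann_sum a L N.+1 F @[N --> \oo] --> integralRn F.
Proof.
move=> L0 cF sF; apply/cvgrPdist_le => e e0.
have LN : 0 < L ^+ n by rewrite exprn_gt0.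
have [N0 HN] := mesh_modulus cF sF (divr_gt0 e0 LN).
exists N0 => // N /= N0N.
have := riemann_sum_approx (ltn0Sn N) L0 cF sF (HN N.+1 (leqW N0N) isT).
by rewrite divfK// gt_eqF.
Qed.

Lemma integralRn_bound a L F B : 0 < L -> continuous F -> supported_in a L F ->
  (forall x, `|F x| <= B) -> `|integralRn F| <= B * L ^+ n.
Proof.
move=> L0 cF sF FB.
apply: (cvgr_to_le (cvg_norm (riemann_sum_cvg L0 cF sF))).
near=> N; rewrite /riemann_sum; apply: le_trans (ler_norm_sum _ _ _) _.
have h0 : 0 <= L / N.+1%:R by rewrite divr_ge0// ltW.
apply: (@le_trans _ _ (\sum_(j : {ffun 'I_n -> 'I_N.+1}) (L / N.+1%:R) ^+ n * B)).
  by apply: ler_sum => j _; rewrite normrM ger0_norm ?exprn_ge0// ler_wpM2l// exprn_ge0.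
rewrite sumr_const card_ffun !card_ord -[leLHS]mulr_natr natrX mulrAC -exprMn mulrC.
by rewrite divfK ?pnatr_eq0.
Unshelve. all: by end_near. Qed.

Lemma integralRn_linear M (c : R) F G :
  continuous F -> continuous G -> vanishes_off M F -> vanishes_off M G ->
  integralRn (fun x => c * F x + G x) = c * integralRn F + integralRn G.
Proof.
move=> cF cG.
wlog M0 : M / 0 <= M.
  move=> H FM GM; apply: (H (Num.max M 0)); first by rewrite le_max lexx orbT.
    by move=> x; rewrite gt_max => /andP[/FM].
  by move=> x; rewrite gt_max => /andP[/GM].
move=> FM GM; have FGM : vanishes_off M (fun x => c * F x + G x).
  by move=> x Mx; rewrite FM// GM// mulr0 addr0.
have L0 : 0 < 2 * M + 1 by lra.
have cFG : continuous (fun x => c * F x + G x).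
  by apply: continuous_add => //; exact: continuous_mull.
have H1 := riemann_sum_cvg L0 cFG (vanishes_off_supported_in M0 FGM).
have HF := riemann_sum_cvg L0 cF (vanishes_off_supported_in M0 FM).
have HG := riemann_sum_cvg L0 cG (vanishes_off_supported_in M0 GM).
have H2 : c * riemann_sum (const_mx (- M)) (2 * M + 1) N.+1 F
  + riemann_sum (const_mx (- M)) (2 * M + 1) N.+1 G @[N --> \oo] -->
    c * integralRn F + integralRn G.
  exact: (cvgD (cvgM (cvg_cst c) HF) HG).
apply: (cvg_unique _ H1); first exact: Rhausdorff.
suff -> : (fun N => riemann_sum (const_mx (- M)) (2 * M + 1) N.+1 (fun x => c * F x + G x))
   = (fun N => c * riemann_sum (const_mx (- M)) (2 * M + 1) N.+1 F
      + riemann_sum (const_mx (- M)) (2 * M + 1) N.+1 G) by exact: H2.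
apply/funext => N; rewrite /riemann_sum mulr_sumr -big_split /=.
by apply: eq_bigr => j _; ring.
Qed.

(** The affine map carries the grid of the preimage cube onto the grid of the given cube, so the
    Riemann sums agree term by term up to the factor [c ^- n]. *)
Lemma integralRn_affine a L (c : R) b F :
  0 < L -> 0 < c -> continuous F -> supported_in a L F ->
  integralRn (fun x => F (c *: x + b)) = c ^- n * integralRn F.
Proof.
move=> L0 c0 cF sF; have c_neq0 : c != 0 by rewrite gt_eqF.
have L1 : 0 < L / c by rewrite divr_gt0.
have sG : supported_in (c^-1 *: (a - b)) (L / c) (fun x => F (c *: x + b)).
  move=> x /sF + i => /(_ i); rewrite !mxE => /andP[H1 H2].
  rewrite mulrC -mulrDl addrAC ler_pdivrMr// ltr_pdivlMr// [x 0 i * _]mulrC; lra.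
have cG : continuous (fun x => F (c *: x + b)).
  move=> x; apply: (continuous_comp (f := fun y => c *: y + b)); last exact: cF.
  exact: affine_continuous.
have HG := riemann_sum_cvg L1 cG sG.
have HF := riemann_sum_cvg L0 cF sF.
have H2 : c ^- n * riemann_sum a L N.+1 F @[N --> \oo] --> c ^- n * integralRn F.
  exact: (cvgM (cvg_cst _) HF).
apply: (cvg_unique _ HG); first exact: Rhausdorff.
suff -> : (fun N => riemann_sum (c^-1 *: (a - b)) (L / c) N.+1 (fun x => F (c *: x + b)))
   = (fun N => c ^- n * riemann_sum a L N.+1 F) by exact: H2.
apply/funext => N; rewrite /riemann_sum mulr_sumr; apply: eq_bigr => j _.
rewrite mulrA -exprVn -exprMn mulrA [c^-1 * L]mulrC; congr (_ * F _).
apply/rowP => i; rewrite !mxE; have : N.+1%:R != 0 :> R by rewrite pnatr_eq0.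
by move: (N.+1%:R : R) ((j i)%:R : R) => m k m0; field; rewrite m0 c_neq0.
Qed.

Lemma integralRn_gt0 a L F x : 0 < L -> continuous F -> supported_in a L F ->
  (forall y, 0 <= F y) -> 0 < F x -> 0 < integralRn F.
Proof.
move=> L0 cF sF F0 Fx.
have e0 : 0 < F x / 2 by rewrite divr_gt0.
have [d d0 Hd] := uniformly_continuous cF (supported_in_vanishes_off sF) e0.
(* By the choice of [d], [F] is at least [F x / 2] on the cube with corner [x] and edge [d], whose
   volume is [d ^+ n]. *)
apply: (@lt_le_trans _ _ (F x / 2 * d ^+ n)); first by rewrite mulr_gt0// exprn_gt0.
have -> : F x / 2 * d ^+ n = (\int[mu]_t (F x / 2 * \1_(cube (x 0) d) t))%R.
  rewrite RintegralZl//; last exact: integrable_indic_cube.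
  congr (_ * _); rewrite /Rintegral integral_indic ?setIT//; last exact: measurable_cube.
  by rewrite [X in fine X](_ : _ = (d ^+ n)%:E)//; apply: lebesgue_cube; exact: ltW.
apply: le_Rintegral => //.
- rewrite (_ : _ \o _ = fun t => ((F x / 2)%:E * (\1_(cube (x 0) d) t)%:E)%E)//.
  by apply: integrableZl => //; exact: integrable_indic_cube.
- exact: integrable_row_of sF.
move=> t _; rewrite indicE; case: (boolP (t \in _)) => [|_]; last by rewrite mulr0.
rewrite inE mulr1 => tx; have : `|x - row_of t| <= d.
  apply: norm_le_coord; first exact: ltW.
  by move=> i; have := tx i; rewrite !mxE => /andP[A B]; rewrite ler_norml; lra.
by move=> /Hd; rewrite ler_norml => /andP[_]; rewrite -/(row_of t); lra.
Qed.

End riemann_sums.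

(** * Regularization of a generalized function *)

Lemma uniform_cvgP (R : realType) (V : choiceType) (f_ : nat -> V -> R) (g : V -> R) :
  {uniform, f_ @ \oo --> g} <->
  forall e, 0 < e -> \forall k \near \oo, forall x, `|f_ k x - g x| <= e.
Proof.
split=> [H e e0|H P /uniform_nbhs[E [entE EP]]].
  apply: (H [set h | forall x, `|h x - g x| <= e]).
  apply/uniform_nbhs; exists [set xy | ball xy.1 e xy.2]; split.
    exact: (entourage_ball _ (PosNum e0)).
  by move=> h Hh x; have := Hh x I; rewrite /ball /= distrC => /ltW.
move: entE; rewrite -entourage_ballE => -[e /= e0 eE].
have e2 : 0 < e / 2 by rewrite divr_gt0.
have := H _ e2; apply: filterS => k Hk; apply: EP => x _.
apply: eE; rewrite /= /ball /= distrC; apply: le_lt_trans (Hk x) _.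
by rewrite ltr_pdivrMr// ltr_pMr// ltr1n.
Qed.

Lemma continuous_dist (R : realType) (T : topologicalType) (f : T -> R) y :
  (forall e, 0 < e -> \forall z \near y, `|f y - f z| <= e) -> {for y, continuous f}.
Proof. by move=> H; apply/cvgrPdist_le. Qed.

(** * Integrals against a compactly supported weight *)

Section weighted_integrals.
Variables (R : realType) (n : nat).
Implicit Types (F G H K phi psi : 'rV[R]_n -> R) (x y b : 'rV[R]_n) (s : seq 'I_n).

Lemma near_norm_le y (r : R) : 0 < r -> \forall z \near y, `|y - z| <= r.
Proof. by move=> r0; apply/nbhs_normP; exists r => //= z /=; exact: ltW. Qed.

Lemma vanishes_off_mul M K H : vanishes_off M K -> vanishes_off M (fun x => K x * H x).
Proof. by move=> KM x /KM ->; rewrite mul0r. Qed.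

(** The weight alone carries the support condition, so [G] and [H] may be constants, translates or
    convolutions. *)
Lemma weighted_integral_linear K M (c : R) G H : continuous K -> vanishes_off M K ->
  continuous G -> continuous H ->
  integralRn (fun x => K x * (c * G x + H x)) =
  c * integralRn (fun x => K x * G x) + integralRn (fun x => K x * H x).
Proof.
move=> cK KM cG cH; rewrite -(@integralRn_linear _ _ M).
- by congr integralRn; apply/funext => x; ring.
- exact: continuous_mul.
- exact: continuous_mul.
- exact: vanishes_off_mul.
- exact: vanishes_off_mul.
Qed.

(** The constant does not depend on [H], and [H] has to be small only where [K] is nonzero; uniform
    estimates thereby become convergence of integrals. *)
Lemma weighted_integral_bound K M : continuous K -> vanishes_off M K ->
  exists2 C, 0 < C & forall H e, continuous H -> 0 <= e ->
    (forall x, K x != 0 -> `|H x| <= e) -> `|integralRn (fun x => K x * H x)| <= C * e.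
Proof.
move=> cK KM; have [B B0 HB] := bounded_vanishes_off cK KM.
pose N := Num.max M 0; have N0 : 0 <= N by rewrite le_max lexx orbT.
have KN : vanishes_off N K by move=> x; rewrite gt_max => /andP[/KM].
have L0 : 0 < 2 * N + 1 by lra.
exists (B * (2 * N + 1) ^+ n); first by rewrite mulr_gt0// exprn_gt0.
move=> H e cH e0 He; rewrite mulrAC.
apply: (integralRn_bound L0 _ (vanishes_off_supported_in N0 (vanishes_off_mul H KN))).
  exact: continuous_mul.
move=> x; rewrite normrM; have [->|Kx] := eqVneq (K x) 0.
  by rewrite normr0 mul0r mulr_ge0// ltW.
by apply: ler_pM => //; exact: He.
Qed.

Lemma continuous_affine2 G (a c : R) y : continuous G ->
  continuous (fun x => G (a *: x + c *: y)).
Proof.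
move=> cG x; apply: (continuous_comp (f := fun x => a *: x + c *: y)); last exact: cG.
exact: affine_continuous.
Qed.

Lemma partial_mean_value G (i : 'I_n) (t : R) x : smooth G ->
  exists2 th, `|th| <= `|t| &
    G (t *: delta_mx 0 i + x) - G x = t * partial i G (th *: delta_mx 0 i + x).
Proof.
move=> GS; pose g (h : R) := G (h *: delta_mx 0 i + x).
have dg (h : R) : is_derive h 1 g (partial i G (h *: delta_mx 0 i + x)).
  exact: (is_derive_line G x (delta_mx 0 i) h _).1 (smooth_is_derive i _ GS).
have cg : continuous g.
  by move=> h; apply/differentiable_continuous/derivable1_diffP; have [] := dg h.
have g0 : G x = g 0 by rewrite /g scale0r add0r.
rewrite g0 -/(g t); have [t0|t0] := leP 0 t.
  have [th + ->] := MVT_segment t0 (fun h _ => dg h) (continuous_subspaceT cg).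
  rewrite in_itv /= => /andP[h1 h2]; exists th; last by rewrite subr0 mulrC.
  by rewrite !ger0_norm.
have [th + E] := MVT_segment (ltW t0) (fun h _ => dg h) (continuous_subspaceT cg).
rewrite in_itv /= => /andP[h1 h2]; exists th.
  by rewrite !ler0_norm ?lerN2// ltW.
by rewrite -opprB E sub0r mulrN opprK mulrC.
Qed.

Lemma norm_delta_mx (i : 'I_n) (t : R) : `|t *: (delta_mx 0 i : 'rV[R]_n)| <= `|t|.
Proof.
apply: norm_le_coord => // j; rewrite !mxE eqxx /=.
by case: (_ == _); rewrite ?mulr1 ?mulr0 ?normr0.
Qed.

(** * Dependence of such integrals on a parameter *)

Section weighted_translates.
Variables (K : 'rV[R]_n -> R) (M : R).
Hypotheses (cK : continuous K) (KM : vanishes_off M K).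

(** The form [a *: x + c *: y] serves two purposes: [a = 1], [c = -1] gives the kernel [G (x - y)],
    while [a = 2^-1 ^+ k], [c = 1] gives averages at scale [2^-1 ^+ k]. *)
Lemma weighted_translate_continuous G N (a c : R) : continuous G -> vanishes_off N G ->
  continuous (fun y => integralRn (fun x => K x * G (a *: x + c *: y))).
Proof.
move=> cG GN y; have [C C0 HC] := weighted_integral_bound cK KM.
apply: continuous_dist => e e0; have eC : 0 < e / C by rewrite divr_gt0.
have [d d0 Hd] := uniformly_continuous cG GN eC.
have d1 : 0 < d / (`|c| + 1) by rewrite divr_gt0// ltr_wpDl.
apply: filterS (near_norm_le y d1) => z yz.
have := weighted_integral_linear (-1) cK KM
  (@continuous_affine2 _ a c z cG) (@continuous_affine2 _ a c y cG).
rewrite mulN1r addrC => <-; rewrite -[leRHS](divfK (lt0r_neq0 C0)) mulrC.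
apply: HC; last 2 first.
- exact: ltW.
- move=> x _; rewrite mulN1r addrC; apply: Hd.
  rewrite opprD addrACA subrr add0r -scalerBr normrZ.
  move: yz; rewrite ler_pdivlMr ?ltr_wpDl// mulrDr mulr1 mulrC.
  have := normr_ge0 (y - z); lra.
apply: continuous_add; last exact: continuous_affine2.
by apply: continuous_mull; exact: continuous_affine2.
Qed.

(** Differentiation under the integral sign: by the mean value theorem and the uniform continuity of
    [partial i G], the difference quotients converge uniformly in [x]. *)
Lemma is_derive_weighted_translate G N (a c : R) (i : 'I_n) y :
  smooth G -> vanishes_off N G ->
  is_derive y (delta_mx 0 i) (fun y => integralRn (fun x => K x * G (a *: x + c *: y)))
    (c * integralRn (fun x => K x * partial i G (a *: x + c *: y))).
Proof.
move=> GS GN; set A := fun y => _; set A' := c * _.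
suff cvgA : h^-1 *: (A (h *: delta_mx 0 i + y) - A y) @[h --> 0^'] --> A'.
  by split; [apply/cvg_ex; exists A'|exact: cvg_lim].
have [C C0 HC] := weighted_integral_bound cK KM.
apply/cvgrPdist_le => e e0.
(* [C] comes from the weight and [c] from the chain rule; the added [1] avoids a division by zero
   when [c = 0]. *)
pose e' := e / (C * (`|c| + 1)).
have C1 : 0 < C * (`|c| + 1) by rewrite mulr_gt0// ltr_wpDl.
have e'0 : 0 < e' by rewrite divr_gt0.
have GS' : smooth (partial i G) := @smooth_partials _ _ [:: i] _ GS.
have [d d0 Hd] := uniformly_continuous (smooth_continuous GS')
  (@vanishes_off_partials _ _ [:: i] _ _ GN) e'0.
have d1 : 0 < d / (`|c| + 1) by rewrite divr_gt0// ltr_wpDl.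
have cGy z := @continuous_affine2 _ a c z (smooth_continuous GS).
near=> h.
have h0 : h != 0 by near: h; exact: nbhs_dnbhs_neq.
have hd : `|h| <= d / (`|c| + 1).
  by near: h; apply: (@dnbhs0_le _ R^o).
pose z := h *: delta_mx 0 i + y.
(* The negated difference quotient, nested so that [weighted_integral_linear] can be applied
   repeatedly. *)
pose H x := (- h^-1) * G (a *: x + c *: z) + (h^-1 * G (a *: x + c *: y) + 0).
have cH1 : continuous (fun x => h^-1 * G (a *: x + c *: y) + 0).
  by apply: continuous_add; [apply: continuous_mull; exact: cGy|exact: cst_continuous].
have cH : continuous H by apply: continuous_add => //; apply: continuous_mull; exact: cGy.
have c0 : continuous (fun _ : 'rV[R]_n => 0 : R) by exact: cst_continuous.
have E : A' - h^-1 *: (A (h *: delta_mx 0 i + y) - A y) =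
    integralRn (fun x => K x * (c * partial i G (a *: x + c *: y) + H x)).
  have cG'y := @continuous_affine2 _ a c y (smooth_continuous GS').
  rewrite (weighted_integral_linear c cK KM cG'y cH).
  rewrite (weighted_integral_linear _ cK KM (cGy z) cH1).
  rewrite (weighted_integral_linear _ cK KM (cGy y) c0).
  have -> : integralRn (fun x => K x * 0) = 0.
    have := weighted_integral_linear (-1) cK KM c0 c0.
    under [X in integralRn X = _]eq_fun do rewrite mulr0 addr0.
    by rewrite mulN1r addNr.
  by rewrite /A' /A -/z /GRing.scale /=; ring.
rewrite E; apply: le_trans (HC _ ((`|c| + 1) * e') _ _ _) _; last 1 first.
- by rewrite mulrA mulrC divfK// gt_eqF.
- apply: continuous_add => //; apply: continuous_mull.
  by apply: continuous_affine2; exact: smooth_continuous.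
- by rewrite mulr_ge0// ltW.
move=> x _; rewrite /H addr0 mulNr addrC -addrA [X in _ + X]addrC addrA.
have -> : a *: x + c *: z = (c * h) *: delta_mx 0 i + (a *: x + c *: y).
  by rewrite /z scalerDr scalerA addrCA.
have [th thh] := partial_mean_value i (c * h) (a *: x + c *: y) GS.
set w := a *: x + c *: y => Ew.
rewrite [X in `|X|](_ : _ =
    c * (partial i G w - partial i G (th *: delta_mx 0 i + w))); last first.
  have -> : G (c * h *: delta_mx 0 i + w) =
      G w + c * h * partial i G (th *: delta_mx 0 i + w).
    by rewrite -Ew [RHS]addrC subrK.
  field.
  done.
rewrite normrM ler_pM ?lerDl//.
apply: Hd; rewrite opprD addrCA subrr addr0 normrN.
apply: le_trans (norm_delta_mx _ _) _; apply: le_trans thh _; rewrite normrM.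
move: hd; rewrite ler_pdivlMr ?ltr_wpDl// mulrDr mulr1 mulrC; have := normr_ge0 h; lra.
Unshelve. all: by end_near. Qed.

Lemma smooth_weighted_translate G N (a c : R) : smooth G -> vanishes_off N G ->
  smooth (fun y => integralRn (fun x => K x * G (a *: x + c *: y))).
Proof.
move=> GS GN; apply: (@smooth_coind _ _ [set f | exists (d : R) (G : 'rV[R]_n -> R),
  [/\ smooth G, vanishes_off N G &
      f = fun y => d * integralRn (fun x => K x * G (a *: x + c *: y))]]); last first.
  by exists 1, G; split => //; apply/funext => y; rewrite mul1r.
move=> _ [d [{GS GN}G [GS GN ->]]]; split.
  by apply: continuous_mull; apply: weighted_translate_continuous GN; exact: smooth_continuous.
move=> i; exists (fun y => d * c * integralRn (fun x => K x * partial i G (a *: x + c *: y))).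
  exists (d * c), (partial i G); split; last by [].
    exact: (@smooth_partials _ _ [:: i] _ GS).
  exact: (@vanishes_off_partials _ _ [:: i] _ _ GN).
move=> y; have dG := @is_derive_weighted_translate _ _ a c i y GS GN.
apply: is_derive_ext (is_deriveZ d dG) _ _ => //.
by rewrite /GRing.scale /= mulrA.
Qed.

Lemma partials_weighted_translate G N (a c : R) s : smooth G -> vanishes_off N G ->
  partials s (fun y => integralRn (fun x => K x * G (a *: x + c *: y))) =
  (fun y => c ^+ size s * integralRn (fun x => K x * partials s G (a *: x + c *: y))).
Proof.
move=> GS GN; elim: s => [|i s IH] /=.
  by apply/funext => y; rewrite expr0 mul1r.
rewrite IH; apply/funext => y; apply: is_deriveE.
have dG := @is_derive_weighted_translate _ _ a c i y
  (smooth_partials s GS) (vanishes_off_partials s GN).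
apply: is_derive_ext (is_deriveZ _ dG) _ _ => //.
by rewrite /GRing.scale /= exprSr mulrA.
Qed.

(** Translating [G] by [c *: y] does not change its modulus of continuity, whence the uniformity in
    [y] that convergence in D(R^n) demands. *)
Lemma riemann_weighted_translate b L G N (c e : R) : 0 < L -> supported_in b L K ->
  continuous G -> vanishes_off N G -> 0 < e ->
  \forall m \near \oo, forall y,
    `|riemann_sum b L m.+1 (fun x => K x * G (1 *: x + c *: y))
      - integralRn (fun x => K x * G (1 *: x + c *: y))| <= e.
Proof.
move=> L0 sK cG GN e0.
have [BK BK0 HBK] := bounded_vanishes_off cK KM.
have [BG BG0 HBG] := bounded_vanishes_off cG GN.
pose V := L ^+ n; have V0 : 0 < V by rewrite exprn_gt0.
(* The product may oscillate by [e / V] on a cell; each factor gets half of this, divided by the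
   bound of the other factor. *)
have eK : 0 < e / V / 2 / BG by rewrite !divr_gt0.
have eG : 0 < e / V / 2 / BK by rewrite !divr_gt0.
have [dK dK0 HdK] := uniformly_continuous cK KM eK.
have [dG dG0 HdG] := uniformly_continuous cG GN eG.
have d0 : 0 < Num.min dK dG by rewrite lt_min dK0.
exists (Num.truncn (L / Num.min dK dG)) => // m /= Hm y.
rewrite distrC -[leRHS](divfK (lt0r_neq0 V0)).
have Lm : L / m.+1%:R <= Num.min dK dG.
  rewrite ler_pdivrMr ?ltr0n// -ler_pdivrMl// mulrC.
  by apply: le_trans (ltW (truncnS_gt _)) _; rewrite ler_nat.
apply: riemann_sum_approx => //.
- by apply: continuous_mul => //; exact: continuous_affine2.
- by move=> x; rewrite mulf_eq0 negb_or => /andP[/sK].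
move=> x x' xx'; have := le_trans xx' Lm; rewrite le_min => /andP[xK xG].
have -> : K x * G (1 *: x + c *: y) - K x' * G (1 *: x' + c *: y) =
  (K x - K x') * G (1 *: x + c *: y) + K x' * (G (1 *: x + c *: y) - G (1 *: x' + c *: y)).
  ring.
apply: le_trans (ler_normD _ _) _; rewrite (splitr (e / V)) lerD// normrM.
  by rewrite -[leRHS](divfK (lt0r_neq0 BG0)) ler_pM// HdK.
rewrite -[leRHS](divfK (lt0r_neq0 BK0)) mulrC ler_pM// HdG//.
by rewrite !scale1r opprD addrACA subrr addr0.
Qed.

End weighted_translates.
End weighted_integrals.

(** * Convolution of a generalized function with test functions *)

Section regularization.
Variables (R : realType) (n : nat).
Implicit Types (F G H K phi psi : 'rV[R]_n -> R) (x y b : 'rV[R]_n) (s : seq 'I_n).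

Lemma tsupport_sub M G : vanishes_off M G -> tsupport G `<=` [set x | `|x| <= M].
Proof.
move=> GM; rewrite /tsupport closureE; apply: smallest_sub.
  by apply: compact_closed; [exact: norm_hausdorff|exact: compact_cball].
by move=> x /= Gx; rewrite leNgt; apply: contra Gx => /GM ->.
Qed.

Lemma integralRn0 : integralRn (fun _ : 'rV[R]_n => 0 : R) = 0.
Proof. by rewrite /integralRn Rintegral_cst// mul0r. Qed.

Lemma test_cvgP (phi_ : nat -> 'rV[R]_n -> R) phi M :
  (forall k, vanishes_off M (phi_ k)) ->
  (forall s e, 0 < e -> \forall k \near \oo, forall y,
      `|partials s (phi_ k) y - partials s phi y| <= e) ->
  test_cvg phi_ phi.
Proof.
move=> phiM H; split; last by move=> s; apply/uniform_cvgP => e; exact: H.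
exists [set x | `|x| <= M]; split; first exact: compact_cball.
by move=> k; exact: tsupport_sub.
Qed.

Lemma reflectE G x : (fun y => G (x - y)) = (fun y => G ((-1) *: y + x)).
Proof. by apply/funext => y; rewrite scaleN1r addrC. Qed.

Lemma test_function_reflect G x : test_function G -> test_function (fun y => G (x - y)).
Proof. by rewrite reflectE; apply: test_function_affine; rewrite oppr_eq0 oner_eq0. Qed.

Lemma partials_reflect s G x : smooth G ->
  partials s (fun y => G (x - y)) = fun y => (-1) ^+ size s * partials s G (x - y).
Proof.
move=> GS; rewrite reflectE partials_affine//; apply/funext => y.
by rewrite scaleN1r addrC.
Qed.

Lemma norm_signed (m : nat) (r : R) : `|(-1) ^+ m * r| = `|r|.
Proof. by rewrite normrM normrX normrN1 expr1n mul1r. Qed.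

Variable u : generalized_function R n.

Lemma convolution_seq_cvg G (z_ : nat -> 'rV[R]_n) x : test_function G ->
  (forall k, `|x - z_ k| <= k.+1%:R^-1) ->
  convolution u G (z_ k) @[k --> \oo] --> convolution u G x.
Proof.
move=> GT Hz; have /test_functionP[GS [M GM]] := GT.
apply: pairing_continuous => [k||]; [exact: test_function_reflect..|].
(* Every [z_ k] is within [1] of [x], which gives the reflected translates a common support. *)
apply: (@test_cvgP _ _ (M + (`|x| + 1))) => [k y|s e e0].
  apply: contraTeq => Gz; rewrite -leNgt.
  have zM : `|z_ k - y| <= M by rewrite leNgt; apply: contra Gz => /GM ->.
  have zx : `|z_ k| <= `|x| + 1.
    rewrite -(subrK x (z_ k)) addrC; apply: le_trans (ler_normD _ _) _.
    rewrite lerD2l distrC.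
    by apply: le_trans (Hz k) _; rewrite invf_le1 ?ler1n ?ltr0n.
  rewrite -[y](subKr (z_ k)); apply: le_trans (ler_normB _ _) _.
  by rewrite addrC lerD.
have [d d0 Hd] := uniformly_continuous (smooth_continuous (smooth_partials s GS))
  (vanishes_off_partials s GM) e0.
exists (Num.truncn d^-1) => // k /= dk y.
rewrite !partials_reflect// -mulrBr norm_signed distrC; apply: Hd.
rewrite opprB addrA subrK; apply: le_trans (Hz k) _.
rewrite -[leRHS]invrK lef_pV2 ?posrE ?invr_gt0 ?ltr0n//.
by apply: le_trans (ltW (truncnS_gt _)) _; rewrite ler_nat.
Qed.

(** The continuity of [u] is sequential, so the argument is by contradiction: bad points are chosen
    at distance at most [k.+1%:R^-1] from [x]. *)
Lemma convolution_continuous G : test_function G -> continuous (convolution u G).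
Proof.
move=> GT x; apply: continuous_dist => e e0; apply: contrapT => Hx.
have /choice[z_ Hz] : forall k : nat, exists z, `|x - z| <= k.+1%:R^-1 /\
    ~ (`|convolution u G x - convolution u G z| <= e).
  move=> k; apply: contrapT => /forallNP Hk; apply: Hx.
  have k0 : 0 < k.+1%:R^-1 :> R by rewrite invr_gt0 ltr0n.
  apply: filterS (near_norm_le x k0) => z xz.
  by have := Hk z; rewrite not_andP => -[//|/contrapT].
have := @convolution_seq_cvg G z_ x GT (fun k => (Hz k).1).
move=> /cvgrPdist_le/(_ _ e0)[k0 _ /(_ k0 (leqnn _))].
by have [_] := Hz k0.
Qed.

Lemma vanishes_off_weighted_translate K G M N (a c B : R) :
  vanishes_off M K -> vanishes_off N G ->
  (forall x y, `|x| <= M -> `|a *: x + c *: y| <= N -> `|y| <= B) ->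
  vanishes_off B (fun y => integralRn (fun x => K x * G (a *: x + c *: y))).
Proof.
move=> KM GN HB y By; rewrite -[RHS]integralRn0; congr integralRn; apply/funext => x.
have [xM|/KM ->] := leP `|x| M; last by rewrite mul0r.
have [xN|/GN ->] := leP `|a *: x + c *: y| N; last by rewrite mulr0.
by have := HB _ _ xM xN; rewrite leNgt By.
Qed.

(** For Riemann sums the identity is the linearity of [u]. Both sides are limits of [u (S m)]: one
    because [S m] converges with all its derivatives, the other because [convolution u G] is
    continuous. *)
Lemma pairing_weighted_reflect K G M : continuous K -> vanishes_off M K -> test_function G ->
  u (fun y => integralRn (fun x => K x * G (x - y))) =
  integralRn (fun x => K x * convolution u G x).
Proof.
move=> cK; wlog M0 : M / 0 <= M.
  move=> H KM GT; apply: (H (Num.max M 0)) => //; first by rewrite le_max lexx orbT.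
  by move=> x; rewrite gt_max => /andP[/KM].
move=> KM GT; have /test_functionP[GS [N GN]] := GT.
have sK := vanishes_off_supported_in M0 KM.
have L0 : 0 < 2 * M + 1 by lra.
set L := 2 * M + 1 in sK L0 *; set a := const_mx (- M) in sK.
have ME : (fun y => integralRn (fun x => K x * G (x - y))) =
   (fun y => integralRn (fun x => K x * G (1 *: x + (-1) *: y))).
  by apply/funext => y; congr integralRn; apply/funext => x; rewrite scale1r scaleN1r.
pose S m y := riemann_sum a L m.+1 (fun x => K x * G (x - y)).
have SE m : S m = fun y => \sum_(j : {ffun 'I_n -> 'I_m.+1})
    ((L / m.+1%:R) ^+ n * K (node a L j)) * G (node a L j - y).
  by apply/funext => y; apply: eq_bigr => j _; rewrite mulrA.
have GrT m (j : {ffun 'I_n -> 'I_m.+1}) := test_function_reflect (node a L j) GT.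
have uS m : u (S m) = riemann_sum a L m.+1 (fun x => K x * convolution u G x).
  by rewrite SE pairing_sum//; apply: eq_bigr => j _; rewrite mulrA.
have Hc : riemann_sum a L m.+1 (fun x => K x * convolution u G x) @[m --> \oo] -->
    integralRn (fun x => K x * convolution u G x).
  apply: riemann_sum_cvg => //.
    by apply: continuous_mul => //; exact: convolution_continuous.
  by move=> x; rewrite mulf_eq0 negb_or => /andP[/sK].
apply/esym; apply: (cvg_unique _ Hc); first exact: Rhausdorff.
suff : u (S m) @[m --> \oo] --> u (fun y => integralRn (fun x => K x * G (x - y))).
  by under eq_fun do rewrite uS.
have GV : forall x y, `|x| <= M -> `|1 *: x + (-1) *: y| <= N -> `|y| <= M + N.
  move=> x y xM; rewrite scale1r scaleN1r => xyN.
  by rewrite -[y](subKr x); apply: le_trans (ler_normB _ _) _; exact: lerD.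
have ST m : test_function (S m) by rewrite SE; exact: sum_test_function.
apply: pairing_continuous; first exact: ST.
  rewrite ME; apply/test_functionP; split.
    exact: (@smooth_weighted_translate _ _ _ _ cK KM _ _ _ _ GS GN).
  by exists (M + N); exact: vanishes_off_weighted_translate GV.
apply: (@test_cvgP _ _ (M + N)) => [m y yMN|s e e0].
  rewrite /S /riemann_sum big1// => j _; set p := node _ _ _.
  have [pM|/KM ->] := leP `|p| M; last by rewrite mul0r mulr0.
  have [pN|/GN ->] := leP `|p - y| N; last by rewrite !mulr0.
  by have := GV p y pM; rewrite scale1r scaleN1r => /(_ pN); rewrite leNgt yMN.
have := riemann_weighted_translate cK KM (-1) L0 sK
  (smooth_continuous (smooth_partials s GS)) (vanishes_off_partials s GN) e0.
apply: filterS => m Hm y; rewrite ME (@partials_weighted_translate _ _ _ _ cK KM _ _ _ _ _ GS GN).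
have -> : partials s (S m) y = (-1) ^+ size s *
    riemann_sum a L m.+1 (fun x => K x * partials s G (1 *: x + (-1) *: y)).
  rewrite SE partials_sum// /riemann_sum mulr_sumr; apply: eq_bigr => j _.
  by rewrite partials_reflect// scale1r scaleN1r; ring.
by rewrite -mulrBr norm_signed.
Qed.

(** Since [K] has integral [1], the error is the [K]-average of [phi (c_ k *: z + y) - phi y], and
    [z] stays in the support of [K], so uniform continuity bounds it; the same holds for every
    derivative. The bound [c_ k <= 1] keeps all supports in one ball. *)
Lemma weighted_translate_test_cvg K M phi (c_ : nat -> R) :
  continuous K -> vanishes_off M K ->
  integralRn K = 1 -> test_function phi ->
  (forall k, 0 <= c_ k <= 1) -> c_ k @[k --> \oo] --> 0 ->
  (forall k, test_function (fun y => integralRn (fun z => K z * phi (c_ k *: z + 1 *: y)))) /\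
  test_cvg (fun k y => integralRn (fun z => K z * phi (c_ k *: z + 1 *: y))) phi.
Proof.
move=> cK; wlog M0 : M / 0 <= M.
  move=> H KM; apply: (H (Num.max M 0)) => //; first by rewrite le_max lexx orbT.
  by move=> x; rewrite gt_max => /andP[/KM].
move=> KM K1 /test_functionP[phiS [N phiN]] c01 c0.
have GV k : forall x y, `|x| <= M -> `|c_ k *: x + 1 *: y| <= N -> `|y| <= M + N.
  move=> x y xM; rewrite scale1r => xyN.
  rewrite -[y](addKr (c_ k *: x)); apply: le_trans (ler_normD _ _) _.
  rewrite lerD// normrN normrZ.
  have /andP[ck0 ck1] := c01 k; rewrite ger0_norm// -[M]mul1r; exact: ler_pM.
have V k : vanishes_off (M + N) (fun y => integralRn (fun z => K z * phi (c_ k *: z + 1 *: y))).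
  exact: vanishes_off_weighted_translate (GV k).
split=> [k|].
  apply/test_functionP; split; last by exists (M + N).
  exact: (@smooth_weighted_translate _ _ _ _ cK KM _ _ _ _ phiS phiN).
apply: test_cvgP V _ => s e e0.
have [C C0 HC] := weighted_integral_bound cK KM.
have eC : 0 < e / C by rewrite divr_gt0.
have cphi := smooth_continuous (smooth_partials s phiS).
have [d d0 Hd] := uniformly_continuous cphi (vanishes_off_partials s phiN) eC.
have dM : 0 < d / (M + 1) by rewrite divr_gt0// ltr_wpDl.
move/cvgrPdist_le : c0 => /(_ _ dM); apply: filterS => k ck y.
rewrite (@partials_weighted_translate _ _ _ _ cK KM _ _ _ _ _ phiS phiN) expr1n mul1r.
have c1 : continuous (fun _ : 'rV[R]_n => 1 : R) by exact: cst_continuous.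
have ck2 := @continuous_affine2 _ _ _ (c_ k) 1 y cphi.
have := weighted_integral_linear (- partials s phi y) cK KM c1 ck2.
under [X in integralRn X]eq_fun do rewrite mulr1.
under [X in _ = _ * integralRn X + _]eq_fun do rewrite mulr1.
rewrite K1 mulr1 addrC => <-; rewrite -[leRHS](divfK (lt0r_neq0 C0)) mulrC.
apply: HC; last 2 first.
- exact: ltW.
- move=> x Kx; rewrite addrC scale1r; apply: Hd; rewrite addrK normrZ.
  have xM : `|x| <= M by rewrite leNgt; apply: contra Kx => /KM ->.
  move: ck; rewrite sub0r normrN ler_pdivlMr ?ltr_wpDl// => ck.
  apply: le_trans ck; apply: ler_pM => //; lra.
by apply: continuous_add; [exact: cst_continuous|].
Qed.

End regularization.

(** * Poisson's equation *)

Section mollifier.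
Variable R : realType.
Implicit Types (s : R).

Definition bump s : R := flat 0 (-1 + 1 * s) * flat 0 (2 + (-1) * s).

Lemma bump_profile : profile bump.
Proof. by apply: profile_mul; exact: profile_flat. Qed.

Lemma bump_ge0 s : 0 <= bump s.
Proof. by rewrite mulr_ge0// flat_ge0. Qed.

Lemma bump_gt0 s : 1 < s < 2 -> 0 < bump s.
Proof.
move=> /andP[s1 s2]; rewrite /bump /flat !expr0 !mul1r.
by rewrite !ifT ?mulr_gt0 ?expR_gt0//; lra.
Qed.

Lemma bump_eq0l s : s < 1 -> bump s = 0.
Proof. by move=> s1; rewrite /bump /flat ifF ?mul0r//; apply/negbTE; rewrite -leNgt; lra. Qed.

Lemma bump_eq0r s : 2 <= s -> bump s = 0.
Proof.
move=> s1; rewrite /bump /flat [X in _ * X]ifF ?mulr0//.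
by apply/negbTE; rewrite -leNgt; lra.
Qed.

Lemma primitive_constant (f F : R -> R) (c s : R) : (forall t : R, is_derive t 1 F (f t)) ->
  (forall t, c <= t -> f t = 0) -> c <= s -> F s = F c.
Proof.
move=> dF f0 cs; apply/eqP; rewrite -subr_eq0.
have cF : continuous F.
  by move=> t; apply/differentiable_continuous/derivable1_diffP; have [] := dF t.
have [t + ->] := MVT_segment cs (fun t _ => dF t) (continuous_subspaceT cF).
by rewrite in_itv /= => /andP[ct _]; rewrite f0// mul0r.
Qed.

Lemma powRD_gt0 s (r t : R) : 0 < s -> s `^ (r + t) = s `^ r * s `^ t.
Proof. by move=> s0; rewrite powRD // (gt_eqF s0) implybT. Qed.

(* For [s = |x|^2] one has [laplacian (h s) = 4 s h'' s + 2 n h' s]. If [th] is constant at infinity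
   and vanishes near [0], [s^(- n / 2) th s] is at infinity, up to a factor, the [s]-derivative of a
   multiple of the fundamental solution; its scaling invariance makes
   [h' s = s^(- n / 2) (th (4 s) - th s)] compactly supported. *)
Lemma ex_radial_profiles (n : nat) : exists g h h1 h2 : R -> R,
  [/\ profile g, profile h, forall t : R, is_derive t 1 h (h1 t) &
      forall t : R, is_derive t 1 h1 (h2 t)] /\
  [/\ forall s, 0 <= g s, forall s, 2 <= s -> g s = 0, forall s, 2 <= s -> h s = 0,
      0 < g (3 / 2) &
      forall s, 0 <= s -> 4 * s * h2 s + 2 * n%:R * h1 s = 2 ^+ n * g (4 * s) - g s].
Proof.
pose a : R := - (n%:R / 2).
have [th [thE dth th0]] := profile_ex_primitive bump_profile ltr01 bump_eq0l.
(* Dilation by [2] multiplies the squared norm by [4]. [D] vanishes below [1 / 4] because [th]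
   vanishes below [1], and from [2] on because [th] is constant there. *)
pose D s := th (4 * s) + (-1) * th s.
have DE : profile D.
  apply: profile_add; first exact: profile_scale.
  by apply: profile_mul => //; exact: profile_cst.
have q0 : (0 : R) < 1 / 4 by lra.
have D0 s : s < 1 / 4 -> D s = 0.
  by move=> s4; rewrite /D !th0 ?mulr0 ?addr0//; lra.
have D2 s : 2 <= s -> D s = 0.
  move=> s2; have thc := primitive_constant dth bump_eq0r.
  by rewrite /D !thc//; lra.
pose q s := s `^ a * D s.
have qE : profile q by exact: profile_powR D0.
have q0l s : s < 1 / 4 -> q s = 0 by move=> /D0; rewrite /q => ->; rewrite mulr0.
have q0r s : 2 <= s -> q s = 0 by move=> /D2; rewrite /q => ->; rewrite mulr0.
have [h [hE dh h0]] := profile_ex_primitive qE q0 q0l.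
have [q' q'E dq] := profile_is_derive qE.
(* As [4 * a + 2 * n%:R = 0], the terms in [D] cancel from [4 * s * q' s + 2 * n%:R * q s]. What
   remains is [4 * s ^ (a + 1)] times the derivative of [D], and [2 ^ n * 4 ^ a = 1] gives it the
   form of the right-hand side. Subtracting [h 2], the constant value of [h] beyond [2], makes the
   second profile vanish there. *)
exists (fun s => s `^ (a + 1) * (4 * bump s)), (fun s => h s + (- h 2)), q, q'.
have b4 : profile (fun s => 4 * bump s).
  by apply: profile_mul; [exact: profile_cst|exact: bump_profile].
split; split.
- apply: (@profile_powR _ _ 1) => // s s1; by rewrite bump_eq0l// mulr0.
- by apply: profile_add => //; exact: profile_cst.
- move=> t; have d0 := is_derive_cst (- h 2) t (1 : R).
  apply: is_derive_ext (is_deriveD (dh t) d0) _ _ => //.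
  by rewrite addr0.
- exact: dq.
- by move=> s; rewrite mulr_ge0 ?powR_ge0// mulr_ge0// bump_ge0.
- by move=> s s2; rewrite bump_eq0r// !mulr0.
- move=> s s2; by rewrite (primitive_constant dh q0r s2) subrr.
- by rewrite mulr_gt0 ?powR_gt0// mulr_gt0// bump_gt0//; lra.
(* The derivative of the power requires [0 < s]; at [0] every term vanishes. *)
move=> s; rewrite le_eqVlt => /predU1P[<-|s0].
  by rewrite !mulr0 mul0r add0r bump_eq0l ?ltr01// !mulr0 subrr q0l ?mulr0//.
have dD : is_derive s 1 D (4 * bump (4 * s) - bump s).
  have H0 : is_derive s 1 (fun t : R => 4 * t) 4.
    by apply: is_derive_ext (is_derive_affine 0 4 s) _ _ => // t; rewrite add0r.
  have H1 : is_derive s 1 (fun t => th (4 * t)) (bump (4 * s) * 4).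
    exact: (is_derive1_comp (dth (4 * s)) H0).
  have H2 := is_deriveZ (-1 : R) (dth s).
  apply: is_derive_ext (is_deriveD H1 H2) _ _ => //.
  by rewrite /GRing.scale /= mulrC mulN1r.
have -> : q' s = a * s `^ (a - 1) * D s + s `^ a * (4 * bump (4 * s) - bump s).
  rewrite -(is_deriveE (dq s)) (is_deriveE (is_deriveM (is_derive1_powR a s0) dD)).
  by rewrite /GRing.scale /=; ring.
have E1 : s `^ a = s * s `^ (a - 1).
  by rewrite -[X in X * _](powRr1 (ltW s0)) -powRD_gt0// subrKC.
have E2 : s `^ (a + 1) = s `^ a * s by rewrite powRD_gt0// powRr1// ltW.
have E3 : 2 ^+ n * (4 * s) `^ (a + 1) = 4 * (s `^ a * s).
  rewrite powRM ?ltW// E2 powRD_gt0// powRr1// mulrA; congr (_ * _).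
  have -> : 4 `^ a = (2 ^+ n)^-1 :> R.
    have -> : (4 : R) = 2 * 2 by ring.
    rewrite powRM// -powRD_gt0// (_ : a + a = - n%:R) ?powRN ?powR_mulrn//.
    by rewrite /a; field.
  by rewrite mulrA divff ?mul1r// expf_neq0.
rewrite mulrA E3 E2 /q.
have -> : 4 * s * (a * s `^ (a - 1) * D s + s `^ a * (4 * bump (4 * s) - bump s)) =
  4 * a * (s * s `^ (a - 1)) * D s + 4 * s * s `^ a * (4 * bump (4 * s) - bump s) by ring.
by rewrite -E1 /a; field.
Qed.

End mollifier.

Lemma ex_mollifier (R : realType) (n : nat) : (0 < n)%N ->
  exists rho psi : 'rV[R]_n -> R,
  [/\ test_function rho, test_function psi, vanishes_off 2 psi, integralRn rho = 1 &
      forall x, laplacian psi x = 2 ^+ n * rho (2 *: x) - rho x].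
Proof.
move=> n_gt0; have [g [h [h1 [h2 [[gE hE dh dh1] [g0 g2 h0 g32 E]]]]]] := ex_radial_profiles R n.
have norm_sqn (x : 'rV[R]_n) : 2 < `|x| -> 2 <= sqn x.
  move=> /ltW x2; apply: (le_trans _ (sqr_norm_le_sqn x)); rewrite expr2.
  by apply: (@le_trans _ _ (2 * 2)); [lra|exact: ler_pM].
have smooth_g : smooth (fun x : 'rV[R]_n => g (sqn x)).
  by apply: radial_smooth; exact: radial_radial.
have smooth_h : smooth (fun x : 'rV[R]_n => h (sqn x)).
  by apply: radial_smooth; exact: radial_radial.
have Vg : vanishes_off 2 (fun x : 'rV[R]_n => g (sqn x)) by move=> x /norm_sqn/g2.
have Vh : vanishes_off 2 (fun x : 'rV[R]_n => h (sqn x)) by move=> x /norm_sqn/h0.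
have Tg : test_function (fun x : 'rV[R]_n => g (sqn x)).
  by apply/test_functionP; split => //; exists 2.
have Th : test_function (fun x : 'rV[R]_n => h (sqn x)).
  by apply/test_functionP; split => //; exists 2.
pose I := integralRn (fun x : 'rV[R]_n => g (sqn x)).
have I0 : 0 < I.
  (* A point with squared norm [3 / 2], where [g] is positive; it needs a coordinate direction,
     hence [0 < n]. *)
  pose x0 : 'rV[R]_n := Num.sqrt (3 / 2) *: delta_mx 0 (Ordinal n_gt0).
  have sx0 : sqn x0 = 3 / 2.
    rewrite sqnZ sqr_sqrtr; last by lra.
    rewrite /sqn (bigD1 (Ordinal n_gt0))//= big1 ?addr0 => [|i i0].
      by rewrite mxE !eqxx expr1n mulr1.
    by rewrite mxE eqxx (negbTE i0) expr0n.
  have L0 : 0 < 2 * 2 + 1 :> R by lra.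
  apply: (integralRn_gt0 (x := x0) L0 _ (vanishes_off_supported_in (ler0n R 2) Vg)) => //.
    exact: smooth_continuous.
  by rewrite sx0.
(* One normalizing factor for both functions, so that the equation between them survives. *)
exists (fun x => I^-1 * g (sqn x)), (fun x => I^-1 * h (sqn x)); split.
- exact: test_function_scale.
- exact: test_function_scale.
- by move=> x /Vh ->; rewrite mulr0.
- have V0 : vanishes_off 2 (fun _ : 'rV[R]_n => 0 : R) by [].
  have c0 : continuous (fun _ : 'rV[R]_n => 0 : R) by exact: cst_continuous.
  have := integralRn_linear I^-1 (smooth_continuous smooth_g) c0 Vg V0.
  under [X in integralRn X]eq_fun do rewrite addr0.
  by rewrite integralRn0 addr0 mulVf// gt_eqF.
move=> x; have -> : laplacian (fun x => I^-1 * h (sqn x)) x =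
    I^-1 * laplacian (fun x : 'rV[R]_n => h (sqn x)) x.
  rewrite /laplacian mulr_sumr; apply: eq_bigr => i _.
  have := partials_linear [:: i; i] I^-1 smooth_h (@smooth_cst R n 0).
  under [X in partials _ X = _]eq_fun do rewrite addr0.
  by move=> ->; rewrite partials_cst0 addr0.
rewrite (laplacian_radial n dh dh1) E; last by rewrite sumr_ge0// => i _; exact: sqr_ge0.
by rewrite sqnZ -[2 ^+ 2]/(2 * 2) (_ : 2 * 2 = 4); ring.
Qed.

(** If [k%:R < |f (x_ k)|] for all [k], uniform convergence of the translates, read at the origin
    alone, keeps [f (x_ (sigma m))] within [1] of [h 0], although [m <= sigma m]. *)
Lemma almost_periodic_bounded (R : realType) (n : nat) (f : 'rV[R]_n -> R) :
  almost_periodic f -> exists2 B, 0 < B & forall x, `|f x| <= B.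
Proof.
move=> [_ H]; apply: contrapT => nB.
have /choice[x_ Hx] : forall k : nat, exists x, k%:R < `|f x|.
  move=> k; apply: contrapT => /forallNP Hk; apply: nB; exists k.+1%:R => // x.
  by have := Hk x; move=> /negP; rewrite -leNgt => /le_trans; apply; rewrite ler_nat.
have [sigma [h [mono /uniform_cvgP/(_ 1 ltr01)[N _ HN]]]] := H x_.
pose m := maxn N (Num.truncn (`|h 0| + 1)).+1.
have := HN m (leq_maxl _ _) 0; rewrite add0r.
have sm : (m <= sigma m)%N.
  by elim: m => // j IH; apply: leq_ltn_trans IH (mono _ _ (ltnSn j)).
have := Hx (sigma m).
have : `|h 0| + 1 < (sigma m)%:R.
  apply: lt_le_trans (truncnS_gt _) _; rewrite ler_nat.
  by apply: leq_trans sm; exact: leq_maxr.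
have := ler_normD (f (x_ (sigma m)) - h 0) (h 0); rewrite subrK; lra.
Qed.

(** The radius [e k] is the sum of all increments from [k] on, so the intervals around [w k x] of
    radius [e k] are nested; [v x] is the supremum of their left ends. *)
Lemma ex_geometric_limit (R : realType) (V : Type) (w : nat -> V -> R) (C : R) :
  0 <= C -> (forall k x, `|w k.+1 x - w k x| <= C * 2^-1 ^+ k) ->
  exists v, forall k x, `|w k x - v x| <= 2 * C * 2^-1 ^+ k.
Proof.
move=> C0 Hw; pose e k : R := 2 * C * 2^-1 ^+ k.
have eS k : e k.+1 = C * 2^-1 ^+ k by rewrite /e exprS; field.
have eS' k : e k = C * 2^-1 ^+ k + C * 2^-1 ^+ k by rewrite /e; ring.
have incr x : {homo (fun k => w k x - e k) : j k / (j <= k)%N >-> j <= k}.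
  apply: homo_leq => // [y z t yz /(le_trans yz)//|k].
  by have := Hw k x; rewrite ler_norml eS eS'; lra.
have decr x : {homo (fun k => w k x + e k) : j k / (j <= k)%N >-> k <= j}.
  apply: homo_leq => // [y z t yz /le_trans/(_ yz)//|k].
  by have := Hw k x; rewrite ler_norml eS eS'; lra.
have e0 k : 0 <= e k by rewrite /e mulr_ge0 ?exprn_ge0// mulr_ge0.
have ab j k x : w j x - e j <= w k x + e k.
  have := incr x _ _ (leq_maxl j k); have := decr x _ _ (leq_maxr j k).
  have := e0 (maxn j k); lra.
exists (fun x => sup (range (fun k => w k x - e k))) => k x.
have ub : ubound (range (fun k => w k x - e k)) (w k x + e k) by move=> _ [j _ <-].
have : w k x - e k <= sup (range (fun k => w k x - e k)).
  by apply: ub_le_sup; [exists (w k x + e k)|exists k].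
have : sup (range (fun k => w k x - e k)) <= w k x + e k.
  by apply: ge_sup => //; exists (w k x - e k), k.
by rewrite -/(e k) ler_norml; lra.
Qed.

Section bounded_functions.
Variables (R : realType) (V : Type).

Lemma bounded_funP (f : V -> R) : bounded_fun f <-> exists B, forall x, `|f x| <= B.
Proof.
split=> [[M [_ HM]]|[B HB]].
  by exists (M + 1) => x; apply: HM => //; rewrite ltrDl.
exists B; split; rewrite ?num_real// => N BN x _ /=.
exact: le_trans (HB x) (ltW BN).
Qed.

End bounded_functions.

(** * Regularized solutions at scale 2^-k *)

Section poisson.
Variables (R : realType) (n : nat) (f : 'rV[R]_n -> R) (u : generalized_function R n).
Variables (rho psi : 'rV[R]_n -> R) (B : R).
Hypotheses (cf : continuous f) (fB : forall x, `|f x| <= B) (u_sol : solves_poisson u f).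
Hypotheses (rhoT : test_function rho) (psiT : test_function psi).
Hypotheses (psiV : vanishes_off 2 psi).
Hypothesis psiE : forall x, laplacian psi x = 2 ^+ n * rho (2 *: x) - rho x.

Definition rescale (phi : 'rV[R]_n -> R) (k : nat) : 'rV[R]_n -> R :=
  fun x => (2 ^+ k) ^+ n * phi (2 ^+ k *: x).

Lemma test_function_rescale phi k : test_function phi -> test_function (rescale phi k).
Proof.
move=> phiT; apply: test_function_scale.
have := test_function_affine 0 (_ : 2 ^+ k != 0 :> R) phiT.
by under eq_fun do rewrite addr0; apply; rewrite expf_neq0.
Qed.

Lemma laplacian_rescale_reflect k x :
  laplacian (fun y => rescale psi k (x - y)) =
  (fun y => (2 ^+ k) ^+ 2 * ((-1) * rescale rho k (x - y) + rescale rho k.+1 (x - y)) + 0).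
Proof.
have [psiS _] := psiT.
pose p y := (2 ^+ k) ^+ n * psi (- 2 ^+ k *: y + 2 ^+ k *: x).
have -> : (fun y => rescale psi k (x - y)) = p.
  by apply/funext => y; rewrite /rescale /p scalerBr scaleNr addrC.
apply/funext => y.
have -> : laplacian p y =
    (2 ^+ k) ^+ n * laplacian (fun y => psi (- 2 ^+ k *: y + 2 ^+ k *: x)) y.
  rewrite /laplacian mulr_sumr; apply: eq_bigr => i _.
  have S1 := smooth_affine (- 2 ^+ k) (2 ^+ k *: x) psiS.
  have := partials_linear [:: i; i] ((2 ^+ k) ^+ n) S1 (@smooth_cst R n 0).
  under [X in partials _ X = _]eq_fun do rewrite addr0.
  by rewrite /p => ->; rewrite partials_cst0 addr0.
rewrite laplacian_affine// psiE sqrrN /rescale.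
have -> : - 2 ^+ k *: y + 2 ^+ k *: x = 2 ^+ k *: (x - y).
  by rewrite scalerBr scaleNr addrC.
by rewrite scalerA -exprS [in (_ ^+ k.+1) ^+ n]exprS exprMn; ring.
Qed.

Lemma convolution_rescale_diff k x :
  convolution u (rescale rho k.+1) x - convolution u (rescale rho k) x =
  - (2 ^+ k) ^- 2 * integralRn (fun y => f y * rescale psi k (x - y)).
Proof.
have T phi j : test_function phi -> test_function (fun y => rescale phi j (x - y)).
  by move=> phiT; apply: test_function_reflect; exact: test_function_rescale.
rewrite -u_sol; last exact: T.
rewrite laplacian_rescale_reflect.
rewrite pairing_linear; [|by apply: test_function_linear; exact: T|exact: test_function0].
rewrite pairing_linear; [|exact: T|exact: T].
rewrite pairing0 addr0 mulrNN mulrA mulVf ?mul1r ?mulN1r 1?addrC// !expf_neq0.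
Qed.

Lemma integral_rescale_bound : exists2 C, 0 <= C &
  forall k x, `|integralRn (fun y => f y * rescale psi k (x - y))| <= C.
Proof.
have [psiS _] := psiT.
have [D D0 psiD] := bounded_vanishes_off (smooth_continuous psiS) psiV.
have B0 : 0 <= B by exact: le_trans (fB 0).
(* A half-open cube of edge [5 / t] contains the closed cube of edge [4 / t] that supports the
   integrand; its volume cancels the factor [t ^+ n] of the rescaled function. *)
exists (B * D * 5 ^+ n); first by rewrite !mulr_ge0// ?exprn_ge0// ltW.
move=> k x; pose t : R := 2 ^+ k; have t0 : 0 < t by rewrite exprn_gt0.
have -> : B * D * 5 ^+ n = B * (t ^+ n * D) * (5 / t) ^+ n.
  by rewrite exprMn exprVn; field; rewrite gt_eqF// exprn_gt0.
have /test_functionP[gS _] := test_function_reflect x (test_function_rescale k psiT).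
apply: (@integralRn_bound _ _ (\row_i (x 0 i - 2 / t))).
- by rewrite divr_gt0.
- by apply: continuous_mul => //; exact: smooth_continuous.
- move=> y; rewrite mulf_eq0 negb_or /rescale mulf_eq0 negb_or => /and3P[_ _ py] i.
  have : `|t *: (x - y)| <= 2 by rewrite leNgt; apply: contra py => /psiV ->.
  rewrite normrZ (ger0_norm (ltW t0)) -ler_pdivlMl// [t^-1 * _]mulrC => xy.
  have := le_trans (coord_le_norm (x - y) i) xy.
  rewrite !mxE ler_norml.
  have -> : 5 / t = 2 / t + 2 / t + t^-1 by field; rewrite gt_eqF.
  have : 0 < t^-1 by rewrite invr_gt0.
  lra.
move=> y; rewrite normrM; apply: ler_pM => //.
by rewrite /rescale normrM ger0_norm ?exprn_ge0// ler_wpM2l// exprn_ge0.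
Qed.

Lemma pairing_rescale_cvg phi : integralRn rho = 1 -> test_function phi ->
  integralRn (fun x => phi x * convolution u (rescale rho k) x) @[k --> \oo] --> u phi.
Proof.
move=> rho1 phiT; have /test_functionP[phiS [N phiV]] := phiT.
have /test_functionP[rhoS [M rhoV]] := rhoT.
have cphi := smooth_continuous phiS; have crho := smooth_continuous rhoS.
have c01 k : 0 <= (2^-1 : R) ^+ k <= 1.
  by rewrite exprn_ge0//= exprn_ile1// invf_le1// ler1n.
have c0 : (2^-1 : R) ^+ k @[k --> \oo] --> 0.
  by apply: cvg_expr; rewrite ger0_norm// invf_lt1// ltr1n.
have [T /(@pairing_continuous _ _ u _ _ T phiT)] :=
  weighted_translate_test_cvg crho rhoV rho1 phiT c01 c0.
suff E k : u (fun y => integralRn (fun z => rho z * phi (2^-1 ^+ k *: z + 1 *: y))) =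
    integralRn (fun x => phi x * convolution u (rescale rho k) x).
  by under eq_fun do rewrite E.
rewrite -(pairing_weighted_reflect _ cphi phiV); last exact: test_function_rescale.
congr (u _); apply/funext => y.
(* The substitution [x = 2^-1 ^+ k *: z + y] moves the scale from [rho] to [phi]; its Jacobian
   cancels the factor in [rescale]. *)
pose F x := phi x * rescale rho k (x - y).
have k0 : 0 < 2^-1 ^+ k :> R by rewrite exprn_gt0.
pose N' := Num.max N 0; have N0 : 0 <= N' by rewrite le_max lexx orbT.
have FV : vanishes_off N' F.
  by move=> x; rewrite /F gt_max => /andP[/phiV -> _]; rewrite mul0r.
have cF : continuous F.
  apply: continuous_mul => //.
  have /test_functionP[gS _] := test_function_rescale k rhoT.
  have ca : continuous (fun x : 'rV[R]_n => x - y).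
    have := @affine_continuous R n 1 (- y).
    rewrite (_ : (fun x => 1 *: x - y) = fun x => x - y)//.
    by apply/funext => x; rewrite scale1r.
  have cr : continuous (rescale rho k) := smooth_continuous gS.
  move=> x; exact: (continuous_comp (ca x) (cr (x - y))).
have L0 : 0 < 2 * N' + 1 by lra.
have := integralRn_affine y L0 k0 cF (vanishes_off_supported_in N0 FV).
have -> : (fun x => F (2^-1 ^+ k *: x + y)) =
    (fun z => (2 ^+ k) ^+ n * (rho z * phi (2^-1 ^+ k *: z + 1 *: y)) + 0).
  apply/funext => z; rewrite /F /rescale addrK scalerA -exprMn divff// expr1n !scale1r; ring.
have c00 : continuous (fun _ : 'rV[R]_n => 0 : R) by exact: cst_continuous.
rewrite (@integralRn_linear _ _ M _ _ (fun=> 0))//; last 2 first.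
- by apply: continuous_mul => //; exact: continuous_affine2.
- exact: vanishes_off_mul.
rewrite integralRn0 addr0 exprVn exprVn invrK => /mulfI; apply.
by rewrite !expf_neq0.
Qed.

End poisson.

Theorem theorem2p2 (R : realType) (n : nat) (n_gt0 : (0 < n)%N)
    (f : 'rV[R]_n -> R) (f_ap : almost_periodic f)
    (u : generalized_function R n) (u_bounded : bounded_generalized_function u)
    (u_sol : solves_poisson u f) :
  exists v : 'rV[R]_n -> R,
    [/\ continuous v, bounded_fun v & given_by u v].
Proof.
have [B B0 fB] := almost_periodic_bounded f_ap.
have [cf _] := f_ap.
have [rho [psi [rhoT psiT psiV rho1 psiE]]] := ex_mollifier R n_gt0.
have [C C0 HC] := integral_rescale_bound cf fB psiT psiV.
pose w k := convolution u (rescale rho k).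
have wS k x : `|w k.+1 x - w k x| <= C * 2^-1 ^+ k.
  rewrite /w (convolution_rescale_diff u_sol rhoT psiT psiE) mulNr normrN normrM mulrC.
  (* The increments are of order [4^-k]; the weaker rate [2^-k] is already summable. *)
  apply: ler_pM => //; rewrite ger0_norm ?invr_ge0 ?exprn_ge0//.
  rewrite exprVn lef_pV2 ?posrE ?exprn_gt0// expr2.
  by rewrite ler_peMl ?exprn_ge0// exprn_ege1// ler1n.
have [v Hv] := ex_geometric_limit C0 wS.
have cw k : continuous (w k) by apply: convolution_continuous; exact: test_function_rescale.
have e_cvg (e : R) : 0 < e -> \forall k \near \oo, 2 * C * 2^-1 ^+ k <= e.
  move=> e0; have : 2 * C * 2^-1 ^+ k @[k --> \oo] --> 2 * C * 0.
    apply: cvgM; first exact: cvg_cst.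
    by apply: cvg_expr; rewrite ger0_norm// invf_lt1// ltr1n.
  rewrite mulr0 => /cvgrPdist_le/(_ _ e0); apply: filterS => k.
  by rewrite sub0r normrN; apply: le_trans; exact: ler_norm.
have wv : {uniform, w @ \oo --> v}.
  apply/uniform_cvgP => e /e_cvg; apply: filterS => k ke x.
  exact: le_trans (Hv k x) ke.
have cv : continuous v.
  apply: uniform_limit_continuous wv.
  by exists 0%N => // k _; exact: cw.
exists v; split => //.
  (* Boundedness of [u] is invoked at the single scale [k = 0]; the geometric estimate carries it
     over to [v]. *)
  have /bounded_funP[D HD] := u_bounded _ (test_function_rescale 0 rhoT).
  apply/bounded_funP; exists (D + 2 * C) => x.
  rewrite -[v x](subKr (w 0%N x)); apply: le_trans (ler_normB _ _) _.
  apply: lerD; first exact: HD.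
  by have := Hv 0%N x; rewrite expr0 mulr1.
move=> phi phiT; have /test_functionP[phiS [N phiV]] := phiT.
have cphi := smooth_continuous phiS.
have Hu := @pairing_rescale_cvg R n u rho rhoT phi rho1 phiT.
(* The integrals of [phi * w k] tend to [u phi], and by uniform convergence also to the integral of
   [phi * v]. *)
apply: (cvg_unique _ Hu); first exact: Rhausdorff.
have -> : (fun x => v x * phi x) = (fun x => phi x * v x) by apply/funext => x; rewrite mulrC.
have [D D0 HD] := weighted_integral_bound cphi phiV.
apply/cvgrPdist_le => e e0.
have := e_cvg _ (divr_gt0 e0 D0); apply: filterS => k ke.
have := weighted_integral_linear (-1) cphi phiV (cw k) cv.
rewrite mulN1r addrC => <-; rewrite -[leRHS](divfK (lt0r_neq0 D0)) mulrC.
apply: HD; last 2 first.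
- exact: ltW (divr_gt0 e0 D0).
- by move=> x _; rewrite mulN1r addrC distrC; exact: le_trans (Hv k x) ke.
by apply: continuous_add => //; exact: continuous_mull.
Qed.
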